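(* Consider the nonautonomous control system described in the context, and let $\alpha:\Omega\to M$ be a continuous $\tau$-equilibrium. Assume that there are $\varepsilon,T>0$ such that for every $\omega\in\Omega$ $$\mathbf{B}_{\varepsilon}(\alpha(\omega\cdot T))\subset\mathbf{R}_T(\omega,\alpha(\omega))\quad\text{and}\quad \mathbf{B}_{\varepsilon}(\alpha(\omega\cdot(-T)))\subset\mathbf{C}_T(\omega,\alpha(\omega)).$$ Then there exists a control set $D\subset\Omega\times M$ containing the graph $\mathrm{gr}(\alpha)=\{(\omega,\alpha(\omega)):\omega\in\Omega\}$ and such that $\alpha(\omega)\in\mathrm{int}\,D_\omega$ for every $\omega\in\Omega$, where $\mathrm{int}\,D_\omega$ is the interior in $M$ of the fiber $D_\omega=\{x\in M:(\omega,x)\in D\}$.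
   Context: Setting. $M$ is a connected $d$-dimensional $C^\infty$-manifold with tangent bundle $TM$; $\Omega$ is a compact metric space with a minimal continuous flow $\sigma:\mathbb{R}\times\Omega\to\Omega$, written $\sigma(t,\omega)=\omega\cdot t$. The maps $f_0,\dots,f_m:\Omega\times M\to TM$ are continuous and every $f_i(\omega,\cdot)$ is a $C^1$ vector field on $M$. $U\subset\mathbb{R}^m$ is compact and convex with $0\in U$, and $\mathcal{U}=\{u\in L^\infty(\mathbb{R},\mathbb{R}^m): u(t)\in U \text{ for almost all } t\in\mathbb{R}\}$. The control system is $\dot x(t)=f_0(\omega\cdot t,x(t))+\sum_{i=1}^m u_i(t)f_i(\omega\cdot t,x(t))$, $u\in\mathcal{U}$. For all $(\omega,x_0,u)\in\Omega\times M\times\mathcal{U}$ there is a unique (Carathéodory) solution $\varphi(t,\omega,x_0,u)$ with $\varphi(0,\omega,x_0,u)=x_0$ on a maximal open interval; any condition involving $\varphi(t,\omega,x_0,u)$ includes that $t$ lies in this interval. Put $\psi(t,\omega,x,u)=(\omega\cdot t,\varphi(t,\omega,x,u))$. The letter $d$ denotes the metric on $\Omega$ and a fixed metric on $M$ compatible with its topology; $\mathbf{B}_\varepsilon(x)$ is the open $d$-ball in $M$. The (local) flow of the uncontrolled system is $\tau(t,\omega,x)=(\omega\cdot t,\varphi(t,\omega,x,0))$. A map $\alpha:\Omega\to M$ is a $\tau$-equilibrium if $\alpha(\omega\cdot t)=\varphi(t,\omega,\alpha(\omega),0)$ for all $t\in\mathbb{R}$ and $\omega\in\Omega$. For $T>0$: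 $\mathbf{R}_T(\omega,x)=\{\varphi(T,\omega,x,u):u\in\mathcal{U}\}$ and $\mathbf{C}_T(\omega,x)=\{y\in M: \exists u\in\mathcal{U},\ x=\varphi(T,\omega\cdot(-T),y,u)\}$. The extended reachable set is $\mathbf{R}^e(\omega,x)=\{\psi(t,\omega,x,u): t\ge0,\ u\in\mathcal{U}\}\subset\Omega\times M$. A nonvoid set $D\subset\Omega\times M$ is a control set if (i) for all $(\omega,x)\in D$ there is $u\in\mathcal{U}$ with $\psi(t,\omega,x,u)\in D$ for all $t\ge0$; (ii) $D\subset\mathrm{cl}\,\mathbf{R}^e(\omega,x)$ for all $(\omega,x)\in D$; and (iii) $D$ is maximal (with respect to inclusion) with these properties. *)

(* Defs.v *)
From HB Require Import structures.
From mathcomp Require Import all_boot all_order all_algebra.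
From mathcomp Require Import all_classical all_reals all_analysis.

Set Implicit Arguments.
Unset Strict Implicit.
Unset Printing Implicit Defensive.

Import Order.TTheory GRing.Theory Num.Theory.
Import numFieldNormedType.Exports.

Local Open Scope classical_set_scope.
Local Open Scope ring_scope.

(* In finite dimension, f is C^(k+1) on the open set V iff it is differentiable
   on V and all its directional derivatives are C^k on V. Only the values of f
   near V matter. *)
Fixpoint Ck (R : realType) (d k : nat) (V : set 'rV[R]_d)
    (f : 'rV[R]_d -> 'rV[R]_d) : Prop :=
  if k is k'.+1 then
    (forall z, V z -> differentiable f z) /\ (forall v, Ck k' V ('D_v f))
  else {in V, continuous f}.

Section Manifold.
Context {R : realType} (M : topologicalType) (d : nat).

(* cmap restricts to a homeomorphism from cdom onto an open subset of R^d, with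
   inverse cinv; the values of cmap off cdom, and of cinv off the image, are
   irrelevant. *)
Record chart := Chart {
  cdom : set M ;
  cmap : M -> 'rV[R]_d ;
  cinv : 'rV[R]_d -> M ;
  cdom_open : open cdom ;
  cimg_open : open (cmap @` cdom) ;
  cmapK : {in cdom, cancel cmap cinv} ;
  cmap_continuous : {in cdom, continuous cmap} ;
  cinv_continuous : {in cmap @` cdom, continuous cinv} }.

Record smooth_atlas := SmoothAtlas {
  charts : set chart ;
  charts_cover : forall x, exists2 c, charts c & cdom c x ;
  charts_compat : forall a b, charts a -> charts b ->
    forall k, Ck k (cmap a @` (cdom a `&` cdom b)) (cmap b \o cinv a) }.

End Manifold.

Arguments cdom {R M d}.
Arguments cmap {R M d}.
Arguments cinv {R M d}.

Section TangentBundle.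
Context {R : realType} {M : topologicalType} {d : nat} (A : smooth_atlas (R := R) M d).

(* A tangent vector at foot is the family of its components in the charts
   around foot, related by the derivatives of the transition maps; the
   component is set to 0 in all other charts, so that equality of records is
   equality of tangent vectors. *)
Record tangent_bundle := TangentVector {
  foot : M ;
  vcomp : chart (R := R) M d -> 'rV[R]_d ;
  vcomp_transition : forall a b, charts A a -> charts A b -> cdom a foot -> cdom b foot ->
    vcomp b = 'd (cmap b \o cinv a) (cmap a foot) (vcomp a) ;
  vcomp_out : forall c, ~ (charts A c /\ cdom c foot) -> vcomp c = 0 }.

HB.instance Definition _ := gen_eqMixin tangent_bundle.
HB.instance Definition _ := gen_choiceMixin tangent_bundle.

(* the bundle charts v |-> (foot v, vcomp v c) identify the part of the bundle
   over cdom c with cdom c * R^d *)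
Definition bundle_subbase : set (set tangent_bundle) :=
  [set W | exists c O V, [/\ charts A c, open O, open V &
    W = [set v | [/\ cdom c (foot v), O (foot v) & V (vcomp v c)]]]].

HB.instance Definition _ :=
  isSubBaseTopological.Build tangent_bundle bundle_subbase id.

Definition C1_vector_field (X : M -> tangent_bundle) :=
  (forall x, foot (X x) = x) /\
  (forall c, charts A c ->
     Ck 1 (cmap c @` cdom c) (fun z => vcomp (X (cinv c z)) c)).

End TangentBundle.

Definition abs_continuous (R : realType) (V : normedModType R) (a b : R)
    (g : R -> V) :=
  forall e : R, 0 < e -> exists2 dl : R, 0 < dl &
    forall (n : nat) (s t : 'I_n -> R),
      (forall i, a <= s i /\ s i <= t i /\ t i <= b) ->
      (forall i j, i != j -> t i <= s j \/ t j <= s i) ->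
      \sum_(i < n) (t i - s i) < dl ->
      \sum_(i < n) `|g (t i) - g (s i)| < e.

Section BaseFlow.
Context {R : realType} {Omega : topologicalType}.

Definition continuous_flow (sigma : R -> Omega -> Omega) :=
  [/\ continuous (fun p : R * Omega => sigma p.1 p.2),
      forall w, sigma 0 w = w &
      forall s t w, sigma (s + t) w = sigma s (sigma t w)].

Definition minimal_flow (sigma : R -> Omega -> Omega) :=
  [set: Omega] !=set0 /\
  forall B : set Omega, closed B -> B !=set0 ->
    (forall t w, B w -> B (sigma t w)) -> B = setT.

End BaseFlow.

Section ControlSystem.
Context {R : realType} {Omega M : topologicalType} {d m : nat}.
Variables (A : smooth_atlas (R := R) M d) (sigma : R -> Omega -> Omega).
Variable f : 'I_m.+1 -> Omega * M -> tangent_bundle A.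
Variable U : set 'rV[R]_m.

(* Controls are functions rather than classes modulo null sets; solutions only
   depend on the class. *)
Definition control (u : R -> 'rV[R]_m) :=
  (forall i, (fun t => u t ord0 i) \in Lfun (@lebesgue_measure R) +oo%E) /\
  {ae @lebesgue_measure R, forall t, U (u t)}.

(* component, in the chart c, of the right-hand side at time t and point x *)
Definition rhs (w : Omega) (u : R -> 'rV[R]_m) (c : chart (R := R) M d)
    (t : R) (x : M) : 'rV[R]_d :=
  vcomp (f ord0 (sigma t w, x)) c +
  \sum_(i < m) u t ord0 i *: vcomp (f (lift ord0 i) (sigma t w, x)) c.

(* Caratheodory solutions on an open interval J containing 0 *)
Definition solution (w : Omega) (u : R -> 'rV[R]_m) (J : set R) (x : R -> M) :=
  [/\ open J /\ is_interval J,
      J 0,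
      {in J, continuous x},
      forall c a b, charts A c -> a <= b ->
        (forall t, a <= t <= b -> J t /\ cdom c (x t)) ->
        abs_continuous a b (cmap c \o x) &
      {ae @lebesgue_measure R, forall t, J t ->
        forall c, charts A c -> cdom c (x t) ->
          is_derive t (1 : R) (cmap c \o x) (rhs w u c t (x t))}].

Variable J : Omega -> M -> (R -> 'rV[R]_m) -> set R.
Variable phi : R -> Omega -> M -> (R -> 'rV[R]_m) -> M.

(* phi ^~ w x0 u is the unique solution starting at x0, and J w x0 u is its
   maximal interval; phi has no meaning off J. *)
Definition solution_map :=
  forall w x0 u, control u ->
    [/\ solution w u (J w x0 u) (fun t => phi t w x0 u),
        phi 0 w x0 u = x0 &
        forall K y, solution w u K y -> y 0 = x0 ->
          K `<=` J w x0 u /\ forall t, K t -> y t = phi t w x0 u].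

Definition psi t w x u : Omega * M := (sigma t w, phi t w x u).

Definition equilibrium (alpha : Omega -> M) :=
  forall t w, J w (alpha w) (fun=> 0) t /\
    alpha (sigma t w) = phi t w (alpha w) (fun=> 0).

Definition reach (T : R) (w : Omega) (x : M) : set M :=
  [set y | exists u, [/\ control u, J w x u T & y = phi T w x u]].

Definition controllable (T : R) (w : Omega) (x : M) : set M :=
  [set y | exists u, [/\ control u, J (sigma (- T) w) y u T &
                         x = phi T (sigma (- T) w) y u]].

Definition ext_reach (w : Omega) (x : M) : set (Omega * M) :=
  [set p | exists t u, [/\ 0 <= t, control u, J w x u t & p = psi t w x u]].

Definition pre_control_set (D : set (Omega * M)) :=
  [/\ D !=set0,
      forall w x, D (w, x) -> exists2 u, control u &
        forall t, 0 <= t -> J w x u t /\ D (psi t w x u) &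
      forall w x, D (w, x) -> D `<=` closure (ext_reach w x)].

Definition control_set (D : set (Omega * M)) :=
  pre_control_set D /\
  forall D', pre_control_set D' -> D `<=` D' -> D' = D.

End ControlSystem.

(* Main.v *)
Require Import Defs.
From HB Require Import structures.
From mathcomp Require Import all_boot all_order all_algebra.
From mathcomp Require Import all_classical all_reals all_analysis.
From mathcomp Require Import measurable_realfun ess_sup_inf lra.

Set Implicit Arguments.
Unset Strict Implicit.
Unset Printing Implicit Defensive.

Import Order.TTheory GRing.Theory Num.Theory.
Import numFieldNormedType.Exports.

Local Open Scope classical_set_scope.
Local Open Scope ring_scope.

(** Write R(w, x) for the extended reachable set of (w, x), and gr for the graph
    of alpha. The control set is D = X /\ Y, where X is the set of points lying
    in the closure of R(w, alpha w) for every w, and Y is the set of points from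
    which some point of gr is reached exactly.

    Three facts make D work.
    - If the closure of R(p) meets gr, then R(p) meets gr: some point of R(p)
      lies within eps of gr in its fiber, and controllability at time T steers
      it onto gr. So D satisfies (ii): from p in D an exact point
      (w, alpha w) is reached, and X is contained in the closure of
      R(w, alpha w). The same remark gives maximality.
    - The ball of radius eps around alpha w, placed in the fiber over w, is
      contained in D. It lies in Y by controllability. It lies in X because
      forward orbits of a minimal flow come back near w after every time: if
      sigma t w1 is close to w with t >= T, then x, being within eps of
      alpha (sigma t w1), is reached from gr at time T, and gr itself is
      followed with the control 0. No continuity of solutions is needed here.
    - X is positively invariant under all controls, whence (i): steer p onto gr,
      then follow gr. Apart from the concatenation of solutions, this is the only
      place where the differential equation is used, through continuous
      dependence on the initial point.

    Continuous dependence is only needed locally in time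
    (local_continuity), since real induction along a trajectory propagates it
    (closure_ext_reach_invariant). The fields are C^1 in x for each frozen w but
    their Lipschitz constants are not controlled along w, so a Gronwall estimate
    is not available; the argument is a compactness one based on uniqueness. In
    a chart, all solutions starting near (w0, x0) exist on a common interval
    [0, t0], stay in a fixed compact ball and share a Lipschitz constant
    (local_bounds). Along an ultrafilter converging to (w0, x0) they converge
    pointwise to a Lipschitz curve y. Near any time t, each of these solutions
    is close to an antiderivative of the right-hand side whose fields are frozen
    at (sigma t w0, y t); this passes to the limit and shows that y solves the
    equation at every t at which the integrals of the controls are
    differentiable with the expected derivative (limit_is_derive). By uniqueness
    y is the solution starting at (w0, x0).

    The passage between almost everywhere differential information and
    increments rests on abs_continuous_lip, a mean value inequality for
    absolutely continuous functions. Curves are shown to be solutions through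
    solutionI, which asks for a local Lipschitz bound and the equation in one
    chart only. *)

(** * Real induction, derivatives and absolute continuity *)

Lemma real_induction (R : realType) (P : R -> Prop) (a b : R) :
  P a ->
  (forall t, a <= t < b -> (forall s, a <= s <= t -> P s) ->
     exists2 e : R, 0 < e & forall s, t < s < t + e -> P s) ->
  (forall t, a < t <= b -> (forall s, a <= s < t -> P s) -> P t) ->
  forall t, a <= t <= b -> P t.
Proof.
move=> Pa Pr Pl t /andP[at_ tb].
pose S := [set r | a <= r <= b /\ forall s, a <= s <= r -> P s].
have Sa : S a.
  split; first by rewrite lexx (le_trans at_).
  by move=> s /andP[as_ sa]; have -> : s = a by apply/le_anti; rewrite as_ sa.
have ubS : ubound S b by move=> r [/andP[_ ->]].
have supS : has_sup S by split; [exists a | exists b].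
have ac : a <= sup S by exact: ub_le_sup supS.2 _ Sa.
have cb : sup S <= b by apply: ge_sup => //; exists a.
set c := sup S in ac cb.
have ltc s : a <= s < c -> P s.
  case/andP=> as_ sc.
  have [r Sr sr] := sup_adherent (eps := c - s) ltac:(by rewrite subr_gt0) supS.
  by apply: Sr.2; rewrite as_ /=; move: sr; rewrite -/c; lra.
have Pc : P c.
  move: ac; rewrite le_eqVlt => /predU1P[<- //|ac].
  by apply: Pl; rewrite ?ac ?cb.
have lec s : a <= s <= c -> P s.
  case/andP=> as_; rewrite le_eqVlt => /predU1P[-> //|sc].
  by apply: ltc; rewrite as_ sc.
move: cb; rewrite le_eqVlt => /predU1P[cb|cb].
  by apply: lec; rewrite at_ cb tb.
have [e e0 Pe] := Pr c ltac:(by rewrite ac cb) lec.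
pose r := Num.min b (c + e / 2).
have rb : r <= b by rewrite /r ge_min lexx.
have re : r <= c + e / 2 by rewrite /r ge_min lexx orbT.
have cr : c < r by rewrite /r lt_min cb /=; lra.
suff Sr : S r by have := ub_le_sup supS.2 Sr; rewrite -/c; lra.
split; first by rewrite rb andbT; lra.
move=> s /andP[as_ sr]; have [sc|cs] := leP s c.
  by apply: lec; rewrite as_ sc.
by apply: Pe; rewrite cs /=; lra.
Qed.

(** Derivatives of curves with values in a normed module, as an estimate on
    increments. *)
Lemma is_deriveP (R : realType) (V : normedModType R) (g : R -> V)
    (t : R) (D : V) :
  is_derive t (1 : R) g D <->
  (forall e : R, 0 < e -> exists2 dl : R, 0 < dl & forall s, `|s - t| < dl ->
     `|g s - g t - (s - t) *: D| <= e * `|s - t|).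
Proof.
split=> [[dg Dg] e e0|H].
  move: dg; rewrite /derivable => /cvg_ex[l gl].
  have lD : l = D by rewrite -Dg; apply/esym/cvg_lim.
  move: gl; rewrite {}lD => /cvgrPdist_lt/(_ e e0).
  rewrite /prop_near1/= /nbhs/= /dnbhs /within/= => -[dl /= dl0 H].
  exists dl => // s sdl; have [->|st] := eqVneq s t.
    by rewrite !subrr scale0r subrr !normr0 mulr0.
  have h0 : s - t != 0 by rewrite subr_eq0.
  have := H (s - t); rewrite /ball_/= sub0r normrN => /(_ sdl h0).
  rewrite [_ *: 1]mulr1 subrK distrC => lte.
  have nz : 0 < `|s - t| by rewrite normr_gt0.
  have -> : g s - g t - (s - t) *: D =
      (s - t) *: ((s - t)^-1 *: (g s - g t) - D).
    by rewrite scalerBr scalerA divff // scale1r.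
  by rewrite normrZ mulrC ler_pM2r // ltW.
suff gD : h^-1 *: (g (h *: 1 + t) - g t) @[h --> 0^'] --> D.
  split; first by apply/cvg_ex; exists D.
  exact/cvg_lim.
apply/cvgrPdist_le => e e0; have [dl dl0 Hd] := H _ e0.
rewrite /prop_near1/= /nbhs/= /dnbhs /within/=.
exists dl => //= h; rewrite /ball_ /= sub0r normrN => hd h0.
rewrite [h *: 1]mulr1.
have := Hd (h + t); rewrite addrK => /(_ hd).
have nz : 0 < `|h| by rewrite normr_gt0.
have -> : g (h + t) - g t - h *: D = h *: (h^-1 *: (g (h + t) - g t) - D).
  by rewrite scalerBr scalerA divff // scale1r.
by rewrite normrZ mulrC ler_pM2r // distrC.
Qed.

Lemma is_derive_norm_le (R : realType) (V : normedModType R) (g : R -> V)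
    (t : R) (D : V) (K e : R) :
  is_derive t (1 : R) g D -> `|D| <= K -> 0 < e ->
  exists2 dl : R, 0 < dl & forall s, `|s - t| < dl ->
    `|g s - g t| <= (K + e) * `|s - t|.
Proof.
move=> /is_deriveP gD DK e0; have [dl dl0 H] := gD e e0.
exists dl => // s /H sdl; rewrite -(subrK ((s - t) *: D) (g s - g t)).
rewrite (le_trans (ler_normD _ _)) // addrC mulrDl lerD //.
by rewrite normrZ mulrC ler_wpM2r.
Qed.

Lemma null_open_cover (R : realType) (N : set R) (e : R) :
  (@lebesgue_measure R).-negligible N -> 0 < e ->
  exists G : set R, [/\ open G, N `<=` G & (lebesgue_measure G < e%:E)%E].
Proof.
move=> [N' [mN' N'0 NN']] e0.
have [|G [oO N'G Oe]] := lebesgue_regularity_outer mN' _ e0.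
  by rewrite [X in (X < _)%E]N'0.
exists G; split=> //; first exact: subset_trans N'G.
have measO : measurable G by exact: open_measurable.
rewrite -(setDUK N'G) measureU //.
- by rewrite [X in (X + _)%E]N'0 add0e.
- exact: measurableD.
- by rewrite setDIK.
Qed.

(** Mean value inequality for absolutely continuous functions whose derivative
    is bounded almost everywhere. The exceptional set is covered by an open set
    G of small measure; [a, b] is exhausted by real induction with steps that
    are either controlled by the derivative at an endpoint or contained in G, and
    the latter contribute little by absolute continuity. *)
Lemma abs_continuous_lip (R : realType) (V : normedModType R) (g : R -> V)
    (a b K : R) :
  a <= b -> 0 <= K -> abs_continuous a b g ->
  {ae @lebesgue_measure R, forall t, a < t < b ->
    exists2 D, is_derive t (1 : R) g D & `|D| <= K} ->
  `|g b - g a| <= K * (b - a).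
Proof.
move=> ab K0 acg gK; apply/ler_addgt0Pr => e e0.
have ba1 : 0 < b - a + 1 by lra.
pose e1 := e / 2 / (b - a + 1).
have e10 : 0 < e1 by rewrite !divr_gt0.
have [dl dl0 acd] := acg (e / 2) ltac:(lra).
have negN : (@lebesgue_measure R).-negligible
    ([set t | ~ (a < t < b -> exists2 D, is_derive t (1 : R) g D & `|D| <= K)]
       `|` ([set a] `|` [set b])).
  apply: negligibleU; first exact: gK.
  by apply: negligibleU; apply/negligibleP => //; exact: lebesgue_measure_set1.
have [G [oO NO Odl]] := null_open_cover negN dl0.
have measO : measurable G by exact: open_measurable.
pose m (s t : R) := fine (lebesgue_measure (G `&` `]s, t])).
have mfin s t : lebesgue_measure (G `&` `]s, t]) \is a fin_num.
  rewrite ge0_fin_numE //; apply: le_lt_trans (ltry dl).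
  by apply/ltW/le_lt_trans/Odl; rewrite le_measure ?inE //; exact: measurableI.
have maD s t : a <= s -> s <= t -> m a t = m a s + m s t.
  move=> as_ st; rewrite /m -fineD // -measureU //; first last.
  - apply/seteqP; split => // x [] [_ /=]; rewrite in_itv/= => /andP[_ xs] [_].
    by rewrite /= in_itv/= ltNge xs.
  - exact: measurableI.
  - exact: measurableI.
  rewrite -setIUr; congr (fine (lebesgue_measure (G `&` _))).
  apply/seteqP; split => x /=; rewrite !in_itv/=.
    by case/andP=> -> xt /=; have [xs|xs] := leP x s; [left|right].
  by case=> /andP[]; lra.
have m_ge0 s t : 0 <= m s t by exact: fine_ge0.
have mO_itv s t : s <= t -> `]s, t]%classic `<=` G -> m s t = t - s.
  move=> st /setIidPr stO; rewrite /m stO lebesgue_measure_itv/= lte_fin.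
  by move: st; rewrite le_eqVlt => /predU1P[->|->] //; rewrite ltxx subrr.
(* P t: the increment over [a, t] is bounded by (K + e1) (t - a), up to the
   increments over a chain l of intervals, listed from right to left, of total
   length at most m a t, the measure of G within ]a, t] *)
pose P t := exists l : seq (R * R),
  [/\ all (fun p => [&& a <= p.1, p.1 <= p.2 & p.2 <= t]) l,
      pairwise (fun p q => q.2 <= p.1) l,
      \sum_(p <- l) (p.2 - p.1) <= m a t &
      `|g t - g a| <= (K + e1) * (t - a) + \sum_(p <- l) `|g p.2 - g p.1| ].
have Pstep1 s t : a <= s -> s <= t -> P s -> `|g t - g s| <= (K + e1) * (t - s) ->
    P t.
  move=> as_ st [l [l1 l2 l3 l4]] gts; exists l; split=> //.
  - apply: sub_all l1 => p /and3P[-> -> ps] /=; exact: le_trans st.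
  - by rewrite (maD s) // (le_trans l3) // lerDl.
  - have -> : g t - g a = (g t - g s) + (g s - g a) by rewrite addrA subrK.
    rewrite (le_trans (ler_normD _ _)) //.
    have -> : (K + e1) * (t - a) = (K + e1) * (t - s) + (K + e1) * (s - a).
      by rewrite -mulrDr addrA subrK.
    by rewrite -addrA lerD.
have Pstep2 s t : a <= s -> s <= t -> P s -> `]s, t]%classic `<=` G -> P t.
  move=> as_ st [l [l1 l2 l3 l4]] stO; exists ((s, t) :: l); split=> //=.
  - rewrite as_ st lexx /=.
    apply: sub_all l1 => p /and3P[-> -> ps] /=; exact: le_trans st.
  - by rewrite l2 andbT; apply: sub_all l1 => p /and3P[].
  - by rewrite big_cons /= (maD s) // (mO_itv _ _ st stO) addrC lerD2r.
  - rewrite big_cons /=.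
    have -> : g t - g a = (g t - g s) + (g s - g a) by rewrite addrA subrK.
    rewrite (le_trans (ler_normD _ _)) //.
    rewrite addrCA lerD2l (le_trans l4) // lerD2r ler_wpM2l //; lra.
(* around each t, P propagates along every interval having t as an endpoint *)
have Ploc t : a <= t <= b -> exists2 r : R, 0 < r &
    forall s s', a <= s -> s <= t -> t <= s' -> `|s - t| < r -> `|s' - t| < r ->
      s = t \/ s' = t -> P s -> P s'.
  move=> /andP[at_ tb].
  have [Ot|nOt] := pselect (G t).
    have /nbhs_ballP[r /= r0 rO] : nbhs t G by exact: open_nbhs_nbhs.
    exists r => // s s' as_ st ts' str s'tr _ Ps.
    apply: (Pstep2 s) => //; first lra.
    move=> x /=; rewrite in_itv/= => /andP[sx xs']; apply: rO.
    rewrite /ball/= distrC; move: str s'tr; rewrite !ltr_norml; lra.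
  have /contrapT gt : ~ ~ (a < t < b ->
      exists2 D, is_derive t (1 : R) g D & `|D| <= K).
    by move=> h; apply/nOt/NO; left.
  have [|D gD DK] := gt.
    rewrite !lt_neqAle at_ tb !andbT.
    apply/andP; split; apply/eqP => h; apply/nOt/NO; right.
      by left.
    by right.
  have [r r0 gr] := is_derive_norm_le gD DK e10.
  exists r => // s s' as_ st ts' str s'tr h Ps.
  apply: (Pstep1 s) => //; first lra.
  case: h => h.
    by rewrite h -[s' - t]ger0_norm ?subr_ge0 //; exact: gr.
  rewrite h distrC -[t - s]ger0_norm ?subr_ge0 // (distrC t); exact: gr.
have Pb : P b.
  apply: (@real_induction R P a b); last by rewrite ab lexx.
  - exists [::]; split => //; rewrite !big_nil ?m_ge0 //.
    by rewrite !subrr normr0 mulr0 add0r.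
  - move=> t /andP[at_ tb] Pt.
    have [r r0 H] := Ploc t ltac:(lra).
    exists r => // s /andP[ts sr]; apply: (H t s) => //; last 1 first.
    + by apply: Pt; rewrite at_ lexx.
    + exact: ltW.
    + by rewrite subrr normr0.
    + by rewrite ger0_norm; lra.
    + by left.
  - move=> t /andP[at_ tb] Pt.
    have [r r0 H] := Ploc t ltac:(lra).
    pose s := Num.max a (t - r / 2).
    have [as_ st sr] : [/\ a <= s, s < t & t - s < r].
      by rewrite /s; case: (leP a (t - r / 2)) => h; split; lra.
    apply: (H s t) => //; last 1 first.
    + by apply: Pt; rewrite as_ st.
    + exact: ltW.
    + by rewrite distrC ger0_norm; lra.
    + by rewrite subrr normr0.
    + by right.
have [l [l1 l2 l3 l4]] := Pb.
have {}acd : \sum_(p <- l) `|g p.2 - g p.1| < e / 2.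
  rewrite (big_nth (0, 0)) big_mkord.
  apply: (acd (size l) 
      (fun i => (nth (0, 0) l i).1) (fun i => (nth (0, 0) l i).2)).
  - move=> i; have /(all_nthP (0, 0))/(_ i (ltn_ord i))/and3P[? ? ?] := l1.
    by do !split.
  - move=> i j; have /(pairwiseP (0, 0)) pl := l2.
    rewrite -val_eqE neq_ltn => /orP[] ij.
      by right; apply: (pl _ _ _ _ ij); rewrite inE ltn_ord.
    by left; apply: (pl _ _ _ _ ij); rewrite inE ltn_ord.
  - have := l3; rewrite (big_nth (0, 0)) big_mkord => /le_lt_trans; apply.
    rewrite -lte_fin fineK //; apply: le_lt_trans Odl.
    by rewrite le_measure ?inE //; exact: measurableI.
apply: (le_trans l4).
have : e1 * (b - a) <= e / 2.
  by rewrite /e1 mulrAC ler_pdivrMr // ler_pM2l; lra.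
move: acd; rewrite mulrDl; lra.
Qed.

(** * Lebesgue null sets and antiderivatives *)

Section LebesgueNullSets.
Context {R : realType}.
Notation mu := (@lebesgue_measure R).

Lemma ae_sub (P Q : R -> Prop) : (forall t, P t -> Q t) ->
  {ae mu, forall t, P t} -> {ae mu, forall t, Q t}.
Proof. by move=> PQ; apply: negligibleS => t /= nQ /PQ. Qed.

Lemma ae_and (P Q : R -> Prop) :
  {ae mu, forall t, P t} -> {ae mu, forall t, Q t} ->
  {ae mu, forall t, P t /\ Q t}.
Proof.
move=> aP aQ; apply: negligibleS (negligibleU aP aQ) => t /= /not_andP[]; by [left|right].
Qed.

Lemma lebesgue_measure_shift (c : R) (A : set R) : measurable A ->
  mu ((fun t => t + c) @^-1` A) = mu A.
Proof.
have mf : measurable_fun [set: measurableTypeR R]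
    (fun t : measurableTypeR R => (t + c : measurableTypeR R)).
  exact: measurable_funD.
move=> mA; apply/esym/(@lebesgue_measure_unique R (pushforward mu
  (fun t : measurableTypeR R => (t + c : measurableTypeR R)))) => //.
move=> X [[a b] _ <-]; rewrite /pushforward /=.
have E : (fun t : R => t + c) @^-1` `]a, b]%classic = `]a - c, b - c]%classic.
  by apply/seteqP; split=> t /=; rewrite !in_itv/=; lra.
transitivity (mu `]a - c, b - c]%classic); last by congr (mu _).
rewrite /= !lebesgue_measure_itv /= !lte_fin ltrD2r; case: ifP => // _.
by congr (_%:E); lra.
Qed.

Lemma ae_shift (c : R) (P : R -> Prop) :
  {ae mu, forall t, P t} -> {ae mu, forall t, P (t + c)}.
Proof.
move=> [N [mN N0 PN]]; exists ((fun t => t + c) @^-1` N); split.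
- rewrite -[X in measurable X]setTI.
  by apply: (measurable_funD (f := id) (g := cst c)).
- by rewrite lebesgue_measure_shift.
- by move=> t /= Pt; exact: PN.
Qed.

(** Lebesgue's differentiation theorem for a bounded measurable function, on the
    positive half-line. *)
Lemma bounded_antiderivative (u : R -> R) (C : R) :
  measurable_fun setT u -> {ae mu, forall t, `|u t| <= C} ->
  exists v : R -> R,
    (forall s t, 0 <= s -> s <= t -> `|v t - v s| <= C * (t - s)) /\
    {ae mu, forall t : R, 0 < t -> is_derive t (1 : R) v (u t)}.
Proof.
move=> mu_ uC.
(* u is only bounded almost everywhere; w is bounded everywhere *)
pose w t := if `|u t| <= C then u t else 0.
have mw : measurable_fun setT w.
  apply: measurable_fun_ifT => //.
  by apply: measurable_fun_ler => //; exact: measurableT_comp.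
have C0 : 0 <= C.
  have [//|C0] := leP 0 C.
  have : mu setT = 0.
    apply/negligibleP => //; move: uC => [N [mN N0 uN]]; exists N; split=> //.
    by move=> t _; apply: uN => /=; have := normr_ge0 (u t); lra.
  by rewrite -set_itvNyy lebesgue_measure_itv.
have wC t : `|w t| <= C by rewrite /w; case: ifP => //; rewrite normr0.
have uw : {ae mu, forall t, w t = u t}.
  by apply: ae_sub uC => t; rewrite /w => ->.
have iw (f : R -> R) (A : set R) : measurable_fun setT f ->
    (forall t, `|f t| <= C) -> measurable A -> (mu A < +oo)%E ->
    mu.-integrable A (EFin \o f).
  move=> mf fC mA Afin; apply: measurable_bounded_integrable => //.
    exact: measurable_funS mf.
  exists C; split; first exact: num_real.
  by move=> x Cx t _; rewrite /= (le_trans (fC t)) // ltW.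
have itv_fin s t b : (mu [set` Interval (BSide b s) (BRight t)] < +oo)%E.
  by rewrite lebesgue_measure_itv /=; case: ifP => // _; exact: ltry.
have lw : locally_integrable setT w.
  split=> //; first exact: openT.
  move=> K _ cK; have mK := compact_measurable cK.
  by have /integrableP[] := iw w K mw wC mK (compact_finite_measure cK).
have i0 y : mu.-integrable `[0, y]%classic (EFin \o w) by exact: iw.
pose v t := (\int[mu]_(r in `[0%R, t]%classic) w r)%R.
have vw := FTC1 i0 lw.
exists v; split.
  move=> s t s0 st.
  rewrite /v (Rintegral_itvB (i0 t)) ?bnd_simp //.
  have ist : mu.-integrable `]s, t]%classic (EFin \o w) by exact: iw.
  apply: le_trans (le_normr_Rintegral _ ist) _ => //.
  apply: le_trans (le_Rintegral (f2 := cst C) _ _ _ _) _ => //.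
  - by apply: iw => //; [exact: measurableT_comp|move=> r; rewrite normr_id].
  - by apply: iw => // r; rewrite ger0_norm.
  - rewrite Rintegral_cst // [X in fine X](_ : _ = (t - s)%:E) //.
    rewrite -[LHS]/(mu _) lebesgue_measure_itv /= lte_fin.
    by move: st; rewrite le_eqVlt => /predU1P[->|-> //]; rewrite ltxx subrr.
apply: ae_sub (ae_and vw uw) => t [vt wt] t0.
have [|dv dvE] := vt; first by [].
by split=> //; rewrite -wt -dvE derive1E.
Qed.

End LebesgueNullSets.

(** * Lipschitz estimates *)

Lemma derive_lip (R : realType) (V : normedModType R) (g : R -> V) (a b K : R) :
  a <= b -> 0 <= K ->
  (forall t : R, a <= t <= b -> exists2 D, is_derive t (1 : R) g D & `|D| <= K) ->
  `|g b - g a| <= K * (b - a).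
Proof.
move=> ab K0 gK; apply/ler_addgt0Pr => e e0.
pose e1 := e / (b - a + 1).
have e10 : 0 < e1 by rewrite divr_gt0 //; lra.
suff : `|g b - g a| <= (K + e1) * (b - a).
  move=> /le_trans; apply; rewrite mulrDl lerD2l /e1 mulrAC ler_pdivrMr; last lra.
  by rewrite ler_pM2l //; lra.
have step (s t : R) : a <= s -> s <= t -> `|g s - g a| <= (K + e1) * (s - a) ->
    `|g t - g s| <= (K + e1) * (t - s) -> `|g t - g a| <= (K + e1) * (t - a).
  move=> as_ st h1 h2.
  have -> : g t - g a = (g t - g s) + (g s - g a) by rewrite addrA subrK.
  apply: le_trans (ler_normD _ _) _.
  by rewrite -(subrK s t) -[X in _ * X]addrA mulrDr lerD // subrK.
apply: (@real_induction R (fun t => `|g t - g a| <= (K + e1) * (t - a)) a b).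
- by rewrite !subrr normr0 mulr0.
- move=> t /andP[at_ tb] Pt.
  have [|D gD DK] := gK t; first by rewrite at_ ltW.
  have [r r0 H] := is_derive_norm_le gD DK e10.
  exists r => // s /andP[ts sr]; apply: (step t) => //; first exact: ltW.
    by apply: Pt; rewrite at_ lexx.
  by rewrite -[s - t]ger0_norm ?subr_ge0 ?(ltW ts) //; apply: H; rewrite ger0_norm; lra.
- move=> t /andP[at_ tb] Pt.
  have [|D gD DK] := gK t; first by rewrite tb ltW.
  have [r r0 H] := is_derive_norm_le gD DK e10.
  pose s := Num.max a (t - r / 2).
  have [as_ st sr] : [/\ a <= s, s < t & t - s < r].
    by rewrite /s; case: (leP a (t - r / 2)) => h; split; lra.
  apply: (step s) => //; first exact: ltW.
    by apply: Pt; rewrite as_ st.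
  rewrite distrC -[t - s]ger0_norm ?subr_ge0 ?(ltW st) // (distrC t); apply: H.
  by rewrite distrC ger0_norm; lra.
- by rewrite ab lexx.
Qed.

Lemma abs_continuous_of_lip (R : realType) (V : normedModType R) (g : R -> V)
    (a b L : R) :
  (forall s t, a <= s -> s <= t -> t <= b -> `|g t - g s| <= L * (t - s)) ->
  abs_continuous a b g.
Proof.
move=> gL e e0; have L1 : 0 < `|L| + 1 by rewrite ltr_wpDl.
exists (e / (`|L| + 1)); first exact: divr_gt0.
move=> n s t H _ Hs.
apply: le_lt_trans (_ : (`|L| + 1) * \sum_(i < n) (t i - s i) < _); last first.
  by rewrite mulrC -ltr_pdivlMr.
rewrite mulr_sumr; apply: ler_sum => i _; have [h1 [h2 h3]] := H i.
apply: le_trans (gL _ _ h1 h2 h3) _; rewrite ler_wpM2r ?subr_ge0 //.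
by rewrite (le_trans (ler_norm L)) // lerDl.
Qed.

Lemma abs_continuous_of_locally_lip (R : realType) (V : normedModType R)
    (g : R -> V) (a b : R) : a <= b ->
  (forall t, a <= t <= b -> exists dl L, 0 < dl /\
     forall s s', `|s - t| < dl -> `|s' - t| < dl ->
       `|g s - g s'| <= L * `|s - s'|) ->
  abs_continuous a b g.
Proof.
move=> ab gl.
pose P t := exists L, forall s s', a <= s -> s <= s' -> s' <= t ->
  `|g s' - g s| <= L * (s' - s).
suff [L HL] : P b by exact: abs_continuous_of_lip HL.
have step r t : a <= r -> r <= t -> P r ->
    (exists L, forall s s', r <= s -> s <= s' -> s' <= t ->
      `|g s' - g s| <= L * (s' - s)) -> P t.
  move=> ar rt [L1 H1] [L2 H2]; exists (Num.max L1 L2) => s s' as_ ss' s't.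
  have le1 x : 0 <= x -> L1 * x <= Num.max L1 L2 * x.
    by move=> x0; rewrite ler_wpM2r // le_max lexx.
  have le2 x : 0 <= x -> L2 * x <= Num.max L1 L2 * x.
    by move=> x0; rewrite ler_wpM2r // le_max lexx orbT.
  have [s'r|rs'] := leP s' r.
    by apply: le_trans (H1 _ _ as_ ss' s'r) (le1 _ _); rewrite subr_ge0.
  have [sr|rs] := leP s r; last first.
    by apply: le_trans (H2 _ _ (ltW rs) ss' s't) (le2 _ _); rewrite subr_ge0.
  have -> : g s' - g s = (g s' - g r) + (g r - g s) by rewrite addrA subrK.
  have -> : s' - s = (s' - r) + (r - s) by rewrite addrA subrK.
  rewrite mulrDr; apply: le_trans (ler_normD _ _) (lerD _ _).
    by apply: le_trans (H2 _ _ _ _ s't) (le2 _ _); rewrite ?subr_ge0 // ltW.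
  by apply: le_trans (H1 _ _ as_ sr _) (le1 _ _); rewrite ?subr_ge0.
apply: (@real_induction R P a b) => //; last by rewrite ab lexx.
- exists 0 => s s' as_ ss' s'a.
  have -> : s' = s by lra.
  by rewrite !subrr normr0 mul0r.
- move=> t /andP[at_ tb] Pt.
  have [|r [L [r0 H]]] := gl t; first by rewrite at_ ltW.
  exists r => // s /andP[ts sr]; apply: (step t) => //; first exact: ltW.
    by apply: Pt; rewrite at_ lexx.
  exists L => s1 s2 h1 h2 h3; rewrite -[s2 - s1]ger0_norm ?subr_ge0 //.
  by apply: H; rewrite ger0_norm; lra.
- move=> t /andP[at_ tb] Pt.
  have [|r [L [r0 H]]] := gl t; first by rewrite tb ltW.
  pose s := Num.max a (t - r / 2).
  have [as_ st sr] : [/\ a <= s, s < t & t - s < r].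
    by rewrite /s; case: (leP a (t - r / 2)) => h; split; lra.
  apply: (step s) => //; first exact: ltW.
    by apply: Pt; rewrite as_ st.
  exists L => s1 s2 h1 h2 h3; rewrite -[s2 - s1]ger0_norm ?subr_ge0 //.
  by apply: H; rewrite ler0_norm; lra.
Qed.

Lemma is_derive_diff_comp (R : realType) (V W : normedModType R) (g : R -> V)
    (tau : V -> W) (t : R) (D : V) :
  is_derive t (1 : R) g D -> differentiable tau (g t) ->
  is_derive t (1 : R) (tau \o g) ('d tau (g t) D).
Proof.
move=> [dg gD] dtau; have difg : differentiable g t by exact/derivable1_diffP.
have dcomp : differentiable (tau \o g) t by exact: differentiable_comp.
split; first exact/derivable1_diffP.
by rewrite deriveE // diff_comp //= -gD deriveE.
Qed.

(** * Charts *)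

Section Charts.
Context {R : realType} {M : topologicalType} {d : nat}.
Variable A : smooth_atlas (R := R) M d.
Implicit Types (a b c : chart (R := R) M d).

Lemma chart_near c x (P : set 'rV[R]_d) : cdom c x ->
  nbhs (cmap c x) P -> \forall y \near x, cdom c y /\ P (cmap c y).
Proof.
move=> cx Px; apply: filterI; first exact: open_nbhs_nbhs (conj (cdom_open c) cx).
exact: (@cmap_continuous _ _ _ c x (mem_set cx) _ Px).
Qed.

Lemma chart_inv_near c x (P : set M) : cdom c x -> nbhs x P ->
  \forall v \near cmap c x, [/\ cdom c (cinv c v), cmap c (cinv c v) = v & P (cinv c v)].
Proof.
move=> cx Px.
have oc : nbhs (cmap c x) (cmap c @` cdom c).
  by apply: open_nbhs_nbhs; split; [exact: cimg_open|exists x].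
have cxE : cinv c (cmap c x) = x by apply: cmapK; exact: mem_set.
have ci : cinv c @ cmap c x --> x.
  rewrite -{2}cxE; apply: cinv_continuous; exact: mem_set (nbhs_singleton oc).
have ciP : \forall v \near cmap c x, P (cinv c v) by exact: ci _ Px.
apply: filterS2 ciP oc => v Pv [y cy yv]; move: Pv.
by rewrite -yv (cmapK (mem_set cy)).
Qed.

Lemma transition_open a b : open (cmap a @` (cdom a `&` cdom b)).
Proof.
rewrite openE => _ [x [ax bx] <-].
have : nbhs x (cdom b) by apply: open_nbhs_nbhs; split=> //; exact: cdom_open.
move/(chart_inv_near ax); apply: filterS => v [av vE bv].
by exists (cinv a v).
Qed.

Lemma transition_differentiable a b x : charts A a -> charts A b ->
  cdom a x -> cdom b x -> differentiable (cmap b \o cinv a) (cmap a x).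
Proof.
move=> ha hb ax bx; have [H _] := charts_compat ha hb 1%N.
by apply: H; exists x.
Qed.

Lemma row_norm_ge (v : 'rV[R]_d) i : `|v ord0 i| <= `|v|.
Proof.
rewrite [leRHS]/Num.norm /= mx_normrE.
by apply: (le_trans _ (le_bigmax _ _ (ord0, i))).
Qed.

(** Transition maps are locally Lipschitz, being C^1. *)
Lemma transition_lip a b x : charts A a -> charts A b -> cdom a x -> cdom b x ->
  exists r L : R, [/\ 0 < r, 0 <= L & forall v v',
    `|v - cmap a x| < r -> `|v' - cmap a x| < r ->
    [/\ cdom a (cinv a v), cdom b (cinv a v) &
        `|cmap b (cinv a v) - cmap b (cinv a v')| <= L * `|v - v'|] ].
Proof.
move=> ha hb ax bx; have [dtau Ctau] := charts_compat ha hb 1%N.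
set tau := cmap b \o cinv a in dtau Ctau.
set V := cmap a @` (cdom a `&` cdom b) in dtau Ctau.
have Vp : V (cmap a x) by exists x.
have oV : open V by exact: transition_open.
pose B (j : 'I_d) := `|'D_(delta_mx 0 j) tau (cmap a x)| + 1.
have nB : \forall v \near cmap a x, forall j, `|'D_(delta_mx 0 j) tau v| <= B j.
  have FF : Filter (nbhs (cmap a x)) by exact: nbhs_filter.
  apply: (@filter_forall _ _ (fun j v => `|'D_(delta_mx 0 j) tau v| <= B j) _ FF) => j.
  have /= := Ctau (delta_mx 0 j) _ (mem_set Vp).
  move=> /cvgrPdist_lt/(_ 1 ltr01); apply: filterS => v.
  rewrite /B distrC => h; rewrite -lerBlDl; apply: le_trans (ltW h).
  exact: lerB_dist.
have nBV : nbhs (cmap a x) ((fun v => forall j, `|'D_(delta_mx 0 j) tau v| <= B j) `&` V).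
  by apply: filterI; [exact: nB|exact: open_nbhs_nbhs].
have /nbhs_ballP[r /= r0 rH] := nBV.
pose L := \sum_j B j.
have L0 : 0 <= L by apply: sumr_ge0 => j _; rewrite addr_ge0.
exists r, L; split=> // v v' vr v'r.
have inr s : 0 <= s <= 1 -> ball (cmap a x) r (v' + s *: (v - v')).
  move=> /andP[s0 s1]; rewrite -ball_normE /= distrC.
  have -> : v' + s *: (v - v') - cmap a x =
    s *: (v - cmap a x) + (1 - s) *: (v' - cmap a x).
    rewrite scalerBl scale1r !scalerBr; apply/rowP => j; rewrite !mxE; lra.
  apply: le_lt_trans (ler_normD _ _) _; rewrite !normrZ !ger0_norm; try lra.
  have := ler_wpM2l s0 (ltW vr); have /ler_wpM2l/(_ _ _ (ltW v'r)) : 0 <= 1 - s by lra.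
  move=> h1 h2; have [s00|s00] := eqVneq s 0.
    by rewrite s00 mul0r add0r subr0 mul1r.
  have : s * `|v - cmap a x| < s * r by rewrite ltr_pM2l // lt_def s00.
  lra.
have Vv : V v by apply: (rH _ _).2; rewrite -ball_normE /= distrC.
have [y [ay by_] yv] := Vv; rewrite -[v in cinv a v]yv (cmapK (mem_set ay)); split=> //.
pose g (s : R) := tau (v' + s *: (v - v')).
have -> : cmap b y = g 1.
  by rewrite /g scale1r addrC subrK /tau /= -yv (cmapK (mem_set ay)).
have -> : cmap b (cinv a v') = g 0 by rewrite /g scale0r addr0.
rewrite -[leRHS]mulr1 -[X in _ * X]subr0; apply: derive_lip => //.
  by rewrite mulr_ge0.
move=> s s01; have [Bs Vs] := rH _ (inr _ s01); have Ds := dtau _ Vs.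
exists ('d tau (v' + s *: (v - v')) (v - v')).
  apply: (@is_derive_diff_comp _ _ _ (fun s => v' + s *: (v - v')) tau) => //.
  apply/is_deriveP => e e0; exists 1 => // r' _.
  rewrite opprD addrACA subrr add0r -scalerBl subrr normr0.
  by rewrite mulr_ge0 // ltW.
have dE q w : differentiable tau q ->
    'd tau q w = \sum_j w ord0 j *: 'D_(delta_mx 0 j) tau q.
  move=> dq; rewrite [w in LHS]matrix_sum_delta big_ord1 linear_sum /=.
  by apply: eq_bigr => j _; rewrite linearZ /= deriveE.
rewrite dE //.
apply: le_trans (ler_norm_sum _ _ _) _; rewrite /L mulr_suml; apply: ler_sum => j _.
rewrite normrZ mulrC ler_pM //; exact: row_norm_ge.
Qed.

End Charts.

Lemma is_derive_near (R : realType) (V : normedModType R) (g h : R -> V)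
    (t e : R) (D : V) : 0 < e ->
  (forall s, `|s - t| < e -> g s = h s) ->
  is_derive t (1 : R) g D -> is_derive t (1 : R) h D.
Proof.
move=> e0 gh /is_deriveP H; apply/is_deriveP => e1 e10.
have [dl dl0 {}H] := H _ e10; exists (Num.min dl e); first by rewrite lt_min dl0.
move=> s; rewrite lt_min => /andP[sdl se]; rewrite -!gh //; first exact: H.
by rewrite subrr normr0.
Qed.

(** * Curves on the manifold and solutions *)

Section LocallyLipschitzCurves.
Context {R : realType} {M : topologicalType} {d : nat}.
Variable A : smooth_atlas (R := R) M d.
Implicit Types (a b c : chart (R := R) M d) (z : R -> M) (S : set R) (t : R).

(** The curve z, restricted to the set of times S, is Lipschitz near t when read
    in any chart around z t. Taking for S a half-line gives the one-sided notion
    used to paste curves. *)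
Definition locally_lip z S t := forall c, charts A c -> cdom c (z t) ->
  exists dl L : R, 0 < dl /\ forall s s', S s -> S s' ->
    `|s - t| < dl -> `|s' - t| < dl ->
    cdom c (z s) /\ `|cmap c (z s) - cmap c (z s')| <= L * `|s - s'|.

(** One chart is enough. *)
Lemma locally_lip_chart a z S t : charts A a -> cdom a (z t) -> S t ->
  (exists dl L : R, 0 < dl /\ forall s s', S s -> S s' ->
    `|s - t| < dl -> `|s' - t| < dl ->
    cdom a (z s) /\ `|cmap a (z s) - cmap a (z s')| <= L * `|s - s'|) ->
  locally_lip z S t.
Proof.
move=> ha az St [dl [L [dl0 H]]] b hb bz.
have [r [L' [r0 L'0 H']]] := transition_lip ha hb az bz.
have L1 : 0 < `|L| + 1 by rewrite ltr_wpDl.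
exists (Num.min dl (r / (`|L| + 1))), (L' * L); split.
  by rewrite lt_min dl0 divr_gt0.
move=> s s' Ss Ss'; rewrite !lt_min => /andP[sdl sr] /andP[s'dl s'r].
have inr q : S q -> `|q - t| < dl -> `|q - t| < r / (`|L| + 1) ->
    cdom a (z q) /\ `|cmap a (z q) - cmap a (z t)| < r.
  move=> Sq qdl qr; have [|aq] := H q t Sq St qdl; first by rewrite subrr normr0.
  move=> /le_lt_trans h; split=> //; apply: h.
  apply: le_lt_trans (_ : (`|L| + 1) * `|q - t| < _).
    by rewrite ler_wpM2r // (le_trans (ler_norm L)) // lerDl.
  by rewrite mulrC -ltr_pdivlMr.
have [as_ sr'] := inr _ Ss sdl sr; have [as' s'r'] := inr _ Ss' s'dl s'r.
have [_] := H' _ _ sr' s'r'; rewrite !(cmapK (mem_set _)) // => bs h; split=> //.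
apply: (le_trans h); rewrite -mulrA ler_wpM2l //.
by have [] := H s s' Ss Ss' sdl s'dl.
Qed.

Lemma locally_lip_sub z z' S S' t (e : R) : 0 < e -> z t = z' t ->
  (forall s, `|s - t| < e -> S' s -> S s /\ z s = z' s) ->
  locally_lip z S t -> locally_lip z' S' t.
Proof.
move=> e0 ztE H lz c hc; rewrite -ztE => cz.
have [dl [L [dl0 {}lz]]] := lz c hc cz.
exists (Num.min dl e), L; split; first by rewrite lt_min dl0.
move=> s s' Ss Ss'; rewrite !lt_min => /andP[sdl se] /andP[s'dl s'e].
have [Ss1 <-] := H s se Ss; have [Ss'1 <-] := H s' s'e Ss'.
exact: lz.
Qed.

Lemma locally_lip_shift z t (k : R) : locally_lip z setT (t + k) ->
  locally_lip (fun s => z (s + k)) setT t.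
Proof.
move=> lz c hc cz; have [dl [L [dl0 {}lz]]] := lz c hc cz.
exists dl, L; split=> // s s' _ _ sdl s'dl.
have -> : s - s' = (s + k) - (s' + k) by lra.
by apply: lz => //; rewrite opprD addrACA subrr addr0.
Qed.

Lemma locally_lip_continuous z t : locally_lip z setT t -> {for t, continuous z}.
Proof.
move=> lz; have [c hc cz] := charts_cover A (z t).
have [dl [L [dl0 {}lz]]] := lz c hc cz.
have L1 : 0 < `|L| + 1 by rewrite ltr_wpDl.
move=> P /(chart_inv_near cz)/nbhs_ballP[r /= r0 rP].
apply/nbhs_ballP; exists (Num.min dl (r / (`|L| + 1))) => /=.
  by rewrite lt_min dl0 divr_gt0.
move=> s; rewrite /ball /= distrC lt_min => /andP[sdl sr].
have [|cs h] := lz s t I I sdl; first by rewrite subrr normr0.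
have [|_ _] := rP (cmap c (z s)); last by rewrite cmapK //; exact: mem_set.
rewrite -ball_normE /= distrC; apply: (le_lt_trans h).
apply: le_lt_trans (_ : (`|L| + 1) * `|s - t| < _).
  by rewrite ler_wpM2r // (le_trans (ler_norm L)) // lerDl.
by rewrite mulrC -ltr_pdivlMr.
Qed.

Lemma locally_lip_lr z t : locally_lip z [set s | s <= t] t ->
  locally_lip z [set s | t <= s] t -> locally_lip z setT t.
Proof.
move=> ll lr c hc cz.
have [dl [L [dl0 {}ll]]] := ll c hc cz.
have [dr [L' [dr0 {}lr]]] := lr c hc cz.
have tt_ : `|t - t| = 0 by rewrite subrr normr0.
exists (Num.min dl dr), (Num.max L L'); split; first by rewrite lt_min dl0.
have le1 x : L * `|x| <= Num.max L L' * `|x| by rewrite ler_wpM2r // le_max lexx.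
have le2 x : L' * `|x| <= Num.max L L' * `|x|.
  by rewrite ler_wpM2r // le_max lexx orbT.
have mixed s s' : s <= t -> t <= s' -> `|s - t| < dl -> `|s' - t| < dr ->
    `|cmap c (z s) - cmap c (z s')| <= Num.max L L' * `|s - s'|.
  move=> st ts' sdl s'dr.
  have [|_ h1] := ll s t st (lexx t) sdl; first by rewrite tt_.
  have [|_ h2] := lr t s' (lexx t) ts' _ s'dr; first by rewrite tt_.
  apply: le_trans (ler_distD (cmap c (z t)) _ _) _.
  have -> : `|s - s'| = `|s - t| + `|t - s'|.
    by rewrite !ler0_norm ?subr_le0 //; lra.
  by rewrite mulrDr lerD // ?(le_trans h1) ?(le_trans h2).
move=> s s' _ _; rewrite !lt_min => /andP[sl sr] /andP[s'l s'r]; split.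
  have [st|ts] := leP s t.
    by have [|] := ll s t st (lexx t) sl; first by rewrite tt_.
  by have [|] := lr s t (ltW ts) (lexx t) sr; first by rewrite tt_.
have [st|ts] := leP s t; have [s't|ts'] := leP s' t.
- by have [_ h] := ll s s' st s't sl s'l; apply: (le_trans h).
- by apply: mixed => //; exact: ltW.
- by rewrite distrC [X in _ * X]distrC; apply: mixed => //; exact: ltW.
- by have [_ h] := lr s s' (ltW ts) (ltW ts') sr s'r; apply: (le_trans h).
Qed.

End LocallyLipschitzCurves.

Section Solutions.
Context {R : realType} {Omega M : topologicalType} {d m : nat}.
Variables (A : smooth_atlas (R := R) M d) (sigma : R -> Omega -> Omega).
Variable f : 'I_m.+1 -> Omega * M -> tangent_bundle A.
Hypothesis f_foot : forall i w x, foot (f i (w, x)) = x.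
Notation mu := (@lebesgue_measure R).

Lemma rhs_transition w u a b t x : charts A a -> charts A b ->
  cdom a x -> cdom b x ->
  rhs sigma f w u b t x = 'd (cmap b \o cinv a) (cmap a x) (rhs sigma f w u a t x).
Proof.
move=> ha hb ax bx.
have E i : vcomp (f i (sigma t w, x)) b =
    'd (cmap b \o cinv a) (cmap a x) (vcomp (f i (sigma t w, x)) a).
  rewrite (vcomp_transition ha hb) ?f_foot //.
rewrite /rhs linearD linear_sum -E; congr (_ + _); apply: eq_bigr => i _.
by rewrite linearZ /= -E.
Qed.

Lemma is_derive_chart w u a b (z : R -> M) t : charts A a -> charts A b ->
  {for t, continuous z} -> cdom a (z t) -> cdom b (z t) ->
  is_derive t (1 : R) (cmap a \o z) (rhs sigma f w u a t (z t)) ->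
  is_derive t (1 : R) (cmap b \o z) (rhs sigma f w u b t (z t)).
Proof.
move=> ha hb cz az bz dz; rewrite (rhs_transition w u t ha hb az bz).
have /cz/nbhs_ballP[e /= e0 eH] : nbhs (z t) (cdom a).
  by apply: open_nbhs_nbhs; split=> //; exact: cdom_open.
apply: is_derive_near (is_derive_diff_comp dz _); first exact: e0.
- move=> s se /=; rewrite cmapK //; apply: mem_set; apply: eH.
  by rewrite /ball /= distrC.
- exact: (transition_differentiable ha hb az bz).
Qed.

(** The curve z satisfies the differential equation at time t, in some chart
    around z t. *)
Definition trajectory w u (z : R -> M) (t : R) := exists c, [/\ charts A c, cdom c (z t) &
  is_derive t (1 : R) (cmap c \o z) (rhs sigma f w u c t (z t))].

Lemma solutionI w u (K : set R) z : open K -> is_interval K -> K 0 ->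
  (forall t, K t -> locally_lip A z setT t) ->
  {ae mu, forall t, K t -> trajectory w u z t} ->
  solution sigma f w u K z.
Proof.
move=> oK iK K0 lz az; split=> //.
- by move=> t; rewrite inE => /lz/locally_lip_continuous.
- move=> c a b hc ab H; apply: abs_continuous_of_locally_lip => // t tab.
  have [Kt ct] := H _ tab; have [dl [L [dl0 h]]] := lz _ Kt c hc ct.
  by exists dl, L; split=> // s s' sdl s'dl; have [] := h s s' I I sdl s'dl.
- apply: ae_sub az => t H Kt c hc ct; have [a [ha at_ dz]] := H Kt.
  by apply: (is_derive_chart ha hc) => //; exact/locally_lip_continuous/lz.
Qed.

Lemma solution_trajectory w u K z : solution sigma f w u K z ->
  {ae mu, forall t, K t -> trajectory w u z t}.
Proof.
move=> [_ _ _ _]; apply: ae_sub => t H Kt.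
by have [c hc cz] := charts_cover A (z t); exists c; split=> //; exact: H.
Qed.

End Solutions.

(** * Regularity, pasting and shifting of solutions *)

Lemma open_shift (R : realType) (k : R) (S : set R) :
  open S -> open [set t | S (t + k)].
Proof.
move=> oS; apply: open_comp oS => t _.
by apply: continuousD; [exact: cvg_id|exact: cvg_cst].
Qed.

Section BundleTopology.
Context {R : realType} {M : topologicalType} {d : nat}.
Variable A : smooth_atlas (R := R) M d.

Lemma bundle_chart_open c (V : set 'rV[R]_d) : charts A c -> open V ->
  open [set v : tangent_bundle A | cdom c (foot v) /\ V (vcomp v c)].
Proof.
move=> hc oV; set W := [set v | _].
exists [set W]; last by rewrite bigcup_set1.
move=> _ ->; apply: finI_from1; exists c, setT, V; split=> //; first exact: openT.
by apply/seteqP; split=> v /= [] *; split.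
Qed.

(** Continuity of a map into the tangent bundle gives continuity of its
    components in a chart. *)
Lemma vcomp_near (T : topologicalType) (g : T -> tangent_bundle A) (p : T) c
    (P : set 'rV[R]_d) : charts A c -> {for p, continuous g} ->
  cdom c (foot (g p)) -> nbhs (vcomp (g p) c) P ->
  \forall q \near p, P (vcomp (g q) c).
Proof.
move=> hc gp cg; rewrite nbhsE => -[V [oV Vp] VP].
have /gp : nbhs (g p) [set v | cdom c (foot v) /\ V (vcomp v c)].
  by apply: open_nbhs_nbhs; split; [exact: bundle_chart_open|].
by move=> h; near=> q; apply: VP; have [] : [set v | cdom c (foot v) /\ V (vcomp v c)] (g q)
  by near: q; exact: h.
Unshelve. all: by end_near. Qed.

End BundleTopology.

Section SolutionRegularity.
Context {R : realType} {Omega M : topologicalType} {d m : nat}.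
Variables (A : smooth_atlas (R := R) M d) (sigma : R -> Omega -> Omega).
Variable f : 'I_m.+1 -> Omega * M -> tangent_bundle A.
Variable U : set 'rV[R]_m.
Hypothesis f_foot : forall i w x, foot (f i (w, x)) = x.
Hypothesis f_continuous : forall i, continuous (f i).
Hypothesis sigma_flow : continuous_flow sigma.
Hypothesis U_compact : compact U.
Notation mu := (@lebesgue_measure R).

Lemma compact_norm_bound : exists2 B : R, 0 <= B & forall v, U v -> `|v| <= B.
Proof.
have [B [_ HB]] := compact_bounded U_compact.
exists (`|B| + 1); first by rewrite addr_ge0.
move=> v Uv; apply: (HB (`|B| + 1)) => //.
by rewrite (le_lt_trans (ler_norm B)) // ltrDl.
Qed.

Lemma rhs_bounded_near (w0 : Omega) (x0 : M) c : charts A c -> cdom c x0 ->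
  exists2 K : R, 0 <= K & \forall p \near (w0, x0),
    forall w u t, sigma t w = p.1 -> U (u t) -> `|rhs sigma f w u c t p.2| <= K.
Proof.
move=> hc cx0; have [B B0 UB] := compact_norm_bound.
pose b i := `|vcomp (f i (w0, x0)) c| + 1.
have b0 i : 0 <= b i by rewrite addr_ge0.
exists (b ord0 + \sum_(i < m) B * b (lift ord0 i)).
  by rewrite addr_ge0 // sumr_ge0 // => i _; rewrite mulr_ge0.
have nb : \forall p \near (w0, x0), forall i, `|vcomp (f i p) c| <= b i.
  have FF : Filter (nbhs (w0, x0)) by exact: nbhs_filter.
  apply: (@filter_forall _ _ (fun i p => `|vcomp (f i p) c| <= b i) _ FF) => i.
  apply: (@vcomp_near _ _ _ A _ (f i) (w0, x0) c (fun v => `|v| <= b i) hc).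
  - exact: f_continuous.
  - by rewrite f_foot.
  - apply/nbhs_ballP; exists 1 => //= v; rewrite -ball_normE /= distrC => h.
    by rewrite /b -lerBlDl; apply: le_trans (ltW h); exact: lerB_dist.
apply: filterS nb => -[w x] nb w' u t /= wE Ut; rewrite /rhs wE.
apply: le_trans (ler_normD _ _) (lerD (nb _) _).
apply: le_trans (ler_norm_sum _ _ _) _; apply: ler_sum => i _.
rewrite normrZ ler_pM //; apply: le_trans (UB _ Ut); exact: row_norm_ge.
Qed.

Lemma flow_time_continuous (w : Omega) : continuous (fun t => sigma t w).
Proof.
move=> t; have [cs _ _] := sigma_flow.
have ct : (fun s : R => (s, w)) @ t --> (t, w).
  exact: cvg_pair cvg_id (cvg_cst w).
exact: cvg_comp ct (cs (t, w)).
Qed.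

Lemma solution_lip w u J z c s s' (K : R) : solution sigma f w u J z ->
  {ae mu, forall t, U (u t)} -> charts A c -> s <= s' -> 0 <= K ->
  (forall r, s <= r <= s' -> J r /\ cdom c (z r)) ->
  (forall r, s <= r <= s' -> U (u r) -> `|rhs sigma f w u c r (z r)| <= K) ->
  `|cmap c (z s') - cmap c (z s)| <= K * (s' - s).
Proof.
move=> [_ _ _ acz dz] Uu hc ss' K0 HJ HK.
apply: (@abs_continuous_lip _ _ (cmap c \o z)) => //; first exact: acz.
apply: ae_sub (ae_and dz Uu) => r [dr Ur] /andP[sr rs'].
have rr : s <= r <= s' by rewrite !ltW.
by have [Jr cr] := HJ _ rr; exists (rhs sigma f w u c r (z r)); [exact: dr|exact: HK].
Qed.

Lemma solution_locally_lip w u J z t : solution sigma f w u J z ->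
  {ae mu, forall t, U (u t)} -> J t -> locally_lip A z setT t.
Proof.
move=> sol Uu Jt c hc ct; have [[oJ _] _ cz _ _] := sol.
have [K K0 HK] := rhs_bounded_near (sigma t w) hc ct.
have czt : {for t, continuous z} by apply: cz; exact: mem_set.
have n1 : \forall s \near t, cdom c (z s).
  by apply: (czt (cdom c)); apply: open_nbhs_nbhs; split=> //; exact: cdom_open.
have n2 : \forall s \near t, J s by apply: open_nbhs_nbhs; split.
have cp : (fun s => (sigma s w, z s)) @ t --> (sigma t w, z t).
  exact: cvg_pair (@flow_time_continuous _ _) czt.
pose N s := forall w' u' t', sigma t' w' = sigma s w -> U (u' t') ->
  `|rhs sigma f w' u' c t' (z s)| <= K.
have n3 : \forall s \near t, N s by exact: cp _ HK.
have nN : nbhs t [set s | [/\ cdom c (z s), J s & N s]].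
  by apply: filterS3 n1 n2 n3 => s *; split.
have /nbhs_ballP[r /= r0 rH] := nN.
have le s s' : s <= s' -> `|s - t| < r -> `|s' - t| < r ->
    `|cmap c (z s') - cmap c (z s)| <= K * (s' - s).
  move=> ss' sr s'r.
  have inr q : s <= q <= s' -> ball t r q.
    move=> /andP[sq qs']; rewrite /ball /= distrC ltr_norml.
    by move: sr s'r; rewrite !ltr_norml; lra.
  apply: (solution_lip sol Uu hc ss' K0) => q /inr/rH[] // cq Jq nq Uq.
  exact: nq.
exists r, K; split=> // s s' _ _ sr s'r; split.
  by have [] := rH s; rewrite /ball /= 1?distrC.
have [ss'|s's] := leP s s'.
  by rewrite distrC [X in _ * X]distrC [X in _ * X]ger0_norm ?subr_ge0 ?ss' //; exact: le.
by rewrite [X in _ * X]ger0_norm ?subr_ge0 ?(ltW s's) //; apply: le => //; exact: ltW.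
Qed.

Lemma trajectory_near w u u' (z z' : R -> M) t (e : R) : 0 < e -> u t = u' t ->
  (forall s, `|s - t| < e -> z s = z' s) ->
  trajectory sigma f w u z t -> trajectory sigma f w u' z' t.
Proof.
move=> e0 uE zE [c [hc ct dz]]; exists c.
have ztE : z t = z' t by apply: zE; rewrite subrr normr0.
rewrite -ztE; split=> //; rewrite /rhs -uE.
by apply: is_derive_near dz; first exact: e0; move=> s /zE /= ->.
Qed.

Lemma rhs_shift w u c (k t : R) x :
  rhs sigma f (sigma k w) (fun s => u (s + k)) c t x = rhs sigma f w u c (t + k) x.
Proof. by have [_ _ sD] := sigma_flow; rewrite /rhs -sD. Qed.

Lemma trajectory_shift w u (z : R -> M) (k t : R) :
  trajectory sigma f w u z (t + k) ->
  trajectory sigma f (sigma k w) (fun s => u (s + k)) (fun s => z (s + k)) t.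
Proof.
move=> [c [hc ct dz]]; exists c; split=> //; rewrite rhs_shift.
move/is_deriveP in dz; apply/is_deriveP => e /dz[dl dl0 H]; exists dl => // s sdl.
have E : s - t = s + k - (t + k) by lra.
by rewrite E; apply: H; rewrite -E.
Qed.

(** Pasting at a time b >= 0. Only one-sided regularity is required at b, so that
    the lemma serves to concatenate controls, to extend a solution beyond a
    limit point, and to complete to the left a curve known for t >= 0. *)
Lemma solution_glue w u1 u2 (b : R) (J1 : set R) (x1 : R -> M) (J2 : set R) (x2 : R -> M) :
  0 <= b -> open J1 -> is_interval J1 -> J1 0 ->
  (forall t, 0 <= t < b -> J1 t) -> open J2 -> is_interval J2 -> J2 b ->
  (forall t, t < b -> J1 t -> locally_lip A x1 setT t) ->
  (forall t, b < t -> J2 t -> locally_lip A x2 setT t) ->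
  locally_lip A (fun t => if t < b then x1 t else x2 t) [set t | t <= b] b ->
  locally_lip A x2 [set t | b <= t] b ->
  {ae mu, forall t, t < b -> J1 t -> trajectory sigma f w u1 x1 t} ->
  {ae mu, forall t, b < t -> J2 t -> trajectory sigma f w u2 x2 t} ->
  solution sigma f w (fun t => if t < b then u1 t else u2 t)
    [set t | if t < b then J1 t else J2 t] (fun t => if t < b then x1 t else x2 t).
Proof.
move=> b0 oJ1 iJ1 J10 J1b oJ2 iJ2 J2b l1 l2 lbl lbr a1 a2.
set z := (z in solution _ _ _ _ _ z).
have zl t s : t < b -> `|s - t| < b - t -> x1 s = z s.
  by move=> tb; rewrite ltr_norml /z => ?; case: ltP => // h; exfalso; lra.
have zr t s : b < t -> `|s - t| < t - b -> x2 s = z s.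
  by move=> tb; rewrite ltr_norml /z => ?; case: ltP => // h; exfalso; lra.
apply: solutionI => //.
- rewrite openE => t /=; case: ltgtP => [tb J1t|bt J2t|-> _]; rewrite /interior.
  + have n1 : \forall s \near t, J1 s by apply: open_nbhs_nbhs; split.
    have n2 : \forall s \near t, s < b by exact: lt_nbhsl.
    by apply: filterS2 n1 n2 => s J1s sb /=; rewrite sb.
  + have n1 : \forall s \near t, J2 s by apply: open_nbhs_nbhs; split.
    have n2 : \forall s \near t, b < s by exact: lt_nbhsr.
    by apply: filterS2 n1 n2 => s J1s sb /=; rewrite ltNge (ltW sb).
  + have n1 : \forall s \near b, J2 s by apply: open_nbhs_nbhs; split.
    have n2 : \forall s \near b, s < b -> J1 s.
      move: b0; rewrite le_eqVlt => /predU1P[b0|b0].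
        have n3 : \forall s \near b, J1 s by apply: open_nbhs_nbhs; split; rewrite -?b0.
        by apply: filterS n3.
      have n3 : \forall s \near b, 0 < s by exact: lt_nbhsr.
      by apply: filterS n3 => s s0 sb; apply: J1b; rewrite sb ltW.
    by apply: filterS2 n1 n2 => s J2s J1s /=; case: ltP.
- move=> s t /=; case: (ltP s b) => [sb Js|bs Js].
    case: (ltP t b) => [tb Jt|bt Jt] r /andP[sr rt].
      have -> : r < b by lra.
      by apply: (iJ1 _ _ Js Jt); rewrite sr rt.
    case: ltP => [rb|br]; last by apply: (iJ2 _ _ J2b Jt); rewrite br rt.
    have [r0|r0] := leP 0 r; first by apply: J1b; rewrite r0.
    by apply: (iJ1 _ _ Js J10); rewrite sr ltW.
  case: (ltP t b) => [tb Jt|bt Jt] r /andP[sr rt]; first lra.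
  by rewrite ltNge (le_trans bs sr) /=; apply: (iJ2 _ _ Js Jt); rewrite sr rt.
- by rewrite /=; case: ltP => // b0'; have <- : b = 0 by apply/le_anti; rewrite b0' b0.
- move=> t /=; case: ltgtP => [tb J1t|bt J2t|-> _].
  + have e0 : 0 < b - t by rewrite subr_gt0.
    apply: (locally_lip_sub e0 _ _ (l1 _ tb J1t)).
      by apply: (zl t t) => //; rewrite subrr normr0.
    by move=> s se _; split=> //; exact: (zl t).
  + have e0 : 0 < t - b by rewrite subr_gt0.
    apply: (locally_lip_sub e0 _ _ (l2 _ bt J2t)).
      by apply: (zr t t) => //; rewrite subrr normr0.
    by move=> s se _; split=> //; exact: (zr t).
  + apply: locally_lip_lr => //.
    apply: (locally_lip_sub ltr01 _ _ lbr); first by rewrite /z ltxx.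
    by move=> s _ /= bs; split=> //; rewrite /z ltNge bs.
- have ab : {ae mu, forall t, t <> b}.
    exists [set b]; split => //; first exact: lebesgue_measure_set1.
    by move=> t /= /contrapT.
  apply: ae_sub (ae_and ab (ae_and a1 a2)) => t [tb [{}a1 {}a2]] /=.
  case: ltgtP => [tb' J1t|bt J2t|//].
  + have e0 : 0 < b - t by rewrite subr_gt0.
    apply: (trajectory_near e0 _ _ (a1 tb' J1t)); first by rewrite tb'.
    by move=> s; exact: (zl t).
  + have e0 : 0 < t - b by rewrite subr_gt0.
    apply: (trajectory_near e0 _ _ (a2 bt J2t)); first by rewrite ltNge (ltW bt).
    by move=> s; exact: (zr t).
Qed.

Lemma solution_shift w u J z (k : R) : solution sigma f w u J z ->
  {ae mu, forall t, U (u t)} -> J k ->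
  solution sigma f (sigma k w) (fun t => u (t + k)) [set t | J (t + k)]
    (fun t => z (t + k)).
Proof.
move=> sol Uu Jk; have [[oJ iJ] _ _ _ _] := sol; apply: solutionI => //.
- exact: open_shift.
- move=> s t Js Jt r /andP[sr rt]; apply: (iJ _ _ Js Jt).
  by rewrite !lerD2r sr rt.
- by rewrite /= add0r.
- move=> t Jt; apply: locally_lip_shift; exact: (solution_locally_lip sol Uu Jt).
- apply: ae_sub (ae_shift k (solution_trajectory sol)) => t H Jt.
  exact/trajectory_shift/H.
Qed.

End SolutionRegularity.

(** * Controls and the solution map *)

Section Controls.
Context {R : realType} {m : nat}.
Variable U : set 'rV[R]_m.
Hypothesis U_compact : compact U.
Notation mu := (@lebesgue_measure R).

(** Since U is bounded, finiteness of the essential suprema is automatic. *)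
Lemma controlP (u : R -> 'rV[R]_m) : control U u <->
  (forall i, measurable_fun setT (fun t => u t ord0 i)) /\
  {ae mu, forall t, U (u t)}.
Proof.
split=> -[mu_ Uu]; split=> // i.
  by have := mu_ i; rewrite inE => /andP[]; rewrite inE.
rewrite inE; apply/andP; split; first by rewrite inE; exact: mu_.
rewrite inE /= /finite_norm unlock /Lnorm.
have [B B0 UB] := compact_norm_bound U_compact.
case: ifP => // _; apply: le_lt_trans (ltry B).
apply/ess_supP; apply: ae_sub Uu => t /UB ut /=.
by rewrite lee_fin (le_trans _ ut) // row_norm_ge.
Qed.

Lemma control0 : U 0 -> control U (fun=> 0).
Proof.
move=> U0; apply/controlP; split; last exact: aeW.
by move=> i; exact: measurable_cst.
Qed.

Lemma control_shift (u : R -> 'rV[R]_m) k : control U u -> control U (fun t => u (t + k)).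
Proof.
move=> /controlP[mu_ Uu]; apply/controlP; split; last exact: (ae_shift k Uu).
move=> i; apply: (measurableT_comp (mu_ i)).
exact: measurable_funD.
Qed.

Lemma control_cat (u1 u2 : R -> 'rV[R]_m) (b : R) : control U u1 -> control U u2 ->
  control U (fun t => if t < b then u1 t else u2 t).
Proof.
move=> /controlP[mu1 Uu1] /controlP[mu2 Uu2]; apply/controlP; split; last first.
  by apply: ae_sub (ae_and Uu1 Uu2) => t []; case: ifP.
move=> i.
rewrite (_ : (fun t => _) =
  (fun t => if t < b then u1 t ord0 i else u2 t ord0 i)); last first.
  by apply/funext => t; case: ifP.
by apply: measurable_fun_ifT => //; exact: measurable_fun_ltr.
Qed.

End Controls.

Section SolutionMap.
Context {R : realType} {Omega M : topologicalType} {d m : nat}.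
Variables (A : smooth_atlas (R := R) M d) (sigma : R -> Omega -> Omega).
Variable f : 'I_m.+1 -> Omega * M -> tangent_bundle A.
Variable U : set 'rV[R]_m.
Variable J : Omega -> M -> (R -> 'rV[R]_m) -> set R.
Variable phi : R -> Omega -> M -> (R -> 'rV[R]_m) -> M.
Hypothesis f_foot : forall i w x, foot (f i (w, x)) = x.
Hypothesis f_continuous : forall i, continuous (f i).
Hypothesis sigma_flow : continuous_flow sigma.
Hypothesis U_compact : compact U.
Hypothesis phi_solution : solution_map sigma f U J phi.
Implicit Types (w : Omega) (x : M) (u : R -> 'rV[R]_m).
Notation mu := (@lebesgue_measure R).

Lemma flow0 w : sigma 0 w = w. Proof. by have [] := sigma_flow. Qed.

Lemma flowD s t w : sigma (s + t) w = sigma s (sigma t w).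
Proof. by have [] := sigma_flow. Qed.

Lemma flowK t w : sigma t (sigma (- t) w) = w.
Proof. by rewrite -flowD subrr flow0. Qed.

Lemma flowNK t w : sigma (- t) (sigma t w) = w.
Proof. by rewrite -flowD addNr flow0. Qed.

Lemma phi_sol w x u : control U u ->
  solution sigma f w u (J w x u) (fun t => phi t w x u).
Proof. by case/(phi_solution w x). Qed.

Lemma phi0 w x u : control U u -> phi 0 w x u = x.
Proof. by case/(phi_solution w x). Qed.

Lemma phi_unique w x u (K : set R) y : control U u -> solution sigma f w u K y ->
  y 0 = x -> forall t, K t -> J w x u t /\ phi t w x u = y t.
Proof.
move=> cu sol y0 t Kt; have [_ _ H] := phi_solution w x cu.
by have [KJ E] := H K y sol y0; split; [exact: KJ|rewrite E].
Qed.

Lemma J0 w x u : control U u -> J w x u 0.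
Proof. by move=> /(phi_sol w x)[]. Qed.

Lemma J_segment w x u s t : control U u -> J w x u t -> 0 <= s <= t -> J w x u s.
Proof.
move=> cu Jt st; have [[_ iJ] J00 _ _ _] := phi_sol w x cu.
exact: iJ J00 Jt _ st.
Qed.

Lemma phi_locally_lip w x u t : control U u -> J w x u t ->
  locally_lip A (fun t => phi t w x u) setT t.
Proof.
move=> cu; apply: (solution_locally_lip f_foot f_continuous sigma_flow U_compact).
  exact: phi_sol.
by have [] := cu.
Qed.

Lemma phi_shift_sub w x u k t : control U u -> J w x u k -> J w x u (t + k) ->
  J (sigma k w) (phi k w x u) (fun s => u (s + k)) t /\
  phi t (sigma k w) (phi k w x u) (fun s => u (s + k)) = phi (t + k) w x u.
Proof.
move=> cu Jk Jtk; have [_ Uu] := cu.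
have sol := solution_shift f_foot f_continuous sigma_flow U_compact (phi_sol w x cu) Uu Jk.
apply: (phi_unique (control_shift U_compact k cu) sol) => //=.
by rewrite add0r.
Qed.

Lemma phi_shift w x u k t : control U u -> J w x u k ->
  J (sigma k w) (phi k w x u) (fun s => u (s + k)) t ->
  J w x u (t + k) /\
  phi (t + k) w x u = phi t (sigma k w) (phi k w x u) (fun s => u (s + k)).
Proof.
move=> cu Jk Jt; have cu' := control_shift U_compact k cu.
have [|JNk phiNk] := @phi_shift_sub w x u k (- k) cu Jk.
  by rewrite addNr; exact: J0.
have := @phi_shift_sub _ _ _ (- k) (t + k) cu' JNk.
rewrite phiNk flowNK addrK addNr phi0 //.
rewrite (_ : (fun s => u (s - k + k)) = u); last by apply/funext => s; rewrite subrK.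
by move=> /(_ Jt).
Qed.

(** If x1 = phi _ w x u1 is defined on [0, b[ and has the limit q at b, in the
    Lipschitz sense, then the maximal solution for the concatenated control
    continues from q at time b. *)
Lemma phi_glue w x u1 u2 (b : R) q : control U u1 -> control U u2 -> 0 <= b ->
  (forall t, 0 <= t < b -> J w x u1 t) -> (b = 0 -> q = x) ->
  locally_lip A (fun t => if t < b then phi t w x u1 else phi (t - b) (sigma b w) q u2)
    [set t | t <= b] b ->
  let u := fun t => if t < b then u1 t else u2 (t - b) in
  (forall t, 0 <= t < b -> J w x u t /\ phi t w x u = phi t w x u1) /\
  (forall t, 0 <= t -> J (sigma b w) q u2 t ->
     J w x u (t + b) /\ phi (t + b) w x u = phi t (sigma b w) q u2).
Proof.
move=> cu1 cu2 b0 Jb qx lbl u.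
have cu : control U u.
  by apply: control_cat => //; exact: (control_shift U_compact (- b)).
have [[oJ1 iJ1] J10 _ _ _] := phi_sol w x cu1.
have sol2 := phi_sol (sigma b w) q cu2.
have [[oJ2 iJ2] J20 _ _ _] := sol2.
pose J2 := [set t | J (sigma b w) q u2 (t - b)].
pose x2 t := phi (t - b) (sigma b w) q u2.
have l2 t : J2 t -> locally_lip A x2 setT t.
  move=> J2t; rewrite /x2.
  by apply: (@locally_lip_shift _ _ _ _ (fun r => phi r (sigma b w) q u2)); exact: phi_locally_lip.
have J2b : J2 b by rewrite /J2 /= subrr.
have sol : solution sigma f w u [set t | if t < b then J w x u1 t else J2 t]
    (fun t => if t < b then phi t w x u1 else x2 t).
  apply: (solution_glue f_foot) => //.
  - exact: open_shift.
  - move=> s t Js Jt r /andP[sr rt]; apply: (iJ2 _ _ Js Jt).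
    by rewrite !lerD2r sr rt.
  - by move=> t _; exact: phi_locally_lip.
  - by move=> t _; exact: l2.
  - by apply: (locally_lip_sub ltr01 _ _ (l2 b J2b)).
  - apply: ae_sub (solution_trajectory (phi_sol w x cu1)) => t H _; exact: H.
  - apply: ae_sub (ae_shift (- b) (solution_trajectory sol2)) => t H _ /H.
    by move/(trajectory_shift sigma_flow); rewrite flowNK.
have sol0 : (if 0 < b then phi 0 w x u1 else x2 0) = x.
  case: ltP => [_|b0']; first exact: phi0.
  have bE : b = 0 by apply/le_anti; rewrite b0' b0.
  by rewrite /x2 bE subr0 phi0 // qx.
have uniq := phi_unique cu sol sol0.
split=> t.
  case/andP=> t0 tb; have := uniq t; rewrite /= tb; apply.
  by apply: Jb; rewrite t0.
move=> t0 Jt; have := uniq (t + b); rewrite /= ltNge lerDr t0 /=.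
by rewrite /J2 /x2 /= addrK; apply.
Qed.

Lemma phi_cat w x u1 u2 (b : R) : control U u1 -> control U u2 -> 0 <= b ->
  J w x u1 b ->
  exists u, [/\ control U u,
    forall t, 0 <= t <= b -> J w x u t /\ phi t w x u = phi t w x u1 &
    forall t, 0 <= t -> J (sigma b w) (phi b w x u1) u2 t ->
      J w x u (t + b) /\ phi (t + b) w x u = phi t (sigma b w) (phi b w x u1) u2].
Proof.
move=> cu1 cu2 b0 Jb; pose u t := if t < b then u1 t else u2 (t - b).
have cu : control U u.
  by apply: control_cat => //; exact: (control_shift U_compact (- b)).
have [|||h1 h2] := @phi_glue w x u1 u2 b (phi b w x u1) cu1 cu2 b0.
- by move=> t /andP[t0 tb]; apply: (J_segment cu1 Jb); rewrite t0 ltW.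
- by move=> ->; rewrite phi0.
- apply: (locally_lip_sub ltr01 _ _ (phi_locally_lip cu1 Jb)).
    by rewrite ltxx subrr phi0.
  move=> s _ /= sb; split=> //; case: ltP => // bs.
  have -> : s = b by apply/le_anti; rewrite sb bs.
  by rewrite subrr phi0.
- exists u; split=> // t /andP[t0]; rewrite le_eqVlt => /predU1P[->|tb].
    have [] := h2 0 (lexx 0) (J0 _ _ cu2); rewrite add0r => Jub.
    by rewrite phi0.
  by apply: h1; rewrite t0.
Qed.

End SolutionMap.

(** * Uniform local existence *)

Lemma lip_left_limit (R : realType) (d : nat) (g : R -> 'rV[R]_d)
    (a b K : R) : a < b -> 0 <= K ->
  (forall s s', a <= s -> s <= s' -> s' < b -> `|g s' - g s| <= K * (s' - s)) ->
  exists l, forall s, a <= s < b -> `|l - g s| <= K * (b - s).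
Proof.
move=> ab K0 gK; have K1 : 0 < K + 1 by lra.
have small e : 0 < e -> exists2 s0 : R, a <= s0 < b & K * (b - s0) < e.
  move=> e0; pose s0 := Num.max a (b - e / (K + 1)).
  have e1 : 0 < e / (K + 1) by exact: divr_gt0.
  have sb : a <= s0 < b by rewrite /s0; case: (leP a (b - e / (K + 1))); lra.
  exists s0 => //.
  have h : b - s0 <= e / (K + 1) by rewrite /s0; case: (leP a (b - e / (K + 1))); lra.
  apply: le_lt_trans (ler_wpM2l K0 h) _.
  by rewrite mulrA ltr_pdivrMr // mulrC ltr_pM2l //; lra.
have cF : cauchy (g @ b^'-).
  apply: cauchy_exP => e e0; have [s0 /andP[as0 s0b] He] := small _ e0.
  exists (g s0).
  have nl : \forall s \near b^'-, s0 < s by exact: nbhs_left_gt.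
  have nr : \forall s \near b^'-, s < b by exact: nbhs_left_lt.
  apply: filterS2 nl nr => s s0s sb /=.
  rewrite -ball_normE /= distrC; apply: le_lt_trans (gK _ _ as0 (ltW s0s) sb) _.
  by apply: le_lt_trans He; rewrite ler_wpM2l // lerD2r ltW.
have cvF : cvg (g @ b^'-) by exact: cauchy_cvg.
pose l : 'rV[R]_d := lim (g @ b^'-).
exists l => s /andP[as_ sb].
have cvl : g @ b^'- --> l by exact: cvF.
apply/ler_addgt0Pr => e e0.
have n1 : \forall r \near b^'-, `|l - g r| < e by move/cvgrPdist_lt: cvl => /(_ e e0).
have n2 : \forall r \near b^'-, s < r by exact: nbhs_left_gt.
have n3 : \forall r \near b^'-, r < b by exact: nbhs_left_lt.
have [r [lr sr rb]] : exists r, [/\ `|l - g r| < e, s < r & r < b].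
  apply: (@filter_ex _ (b^'-)).
  by apply: filterS3 n1 n2 n3 => r *; split.
apply: le_trans (ler_distD (g r) _ _) _; rewrite addrC lerD //; last exact: ltW.
apply: le_trans (gK _ _ as_ (ltW sr) rb) _.
by rewrite ler_wpM2l // lerD2r ltW.
Qed.

Section LocalExistence.
Context {R : realType} {Omega M : topologicalType} {d m : nat}.
Variables (A : smooth_atlas (R := R) M d) (sigma : R -> Omega -> Omega).
Variable f : 'I_m.+1 -> Omega * M -> tangent_bundle A.
Variable U : set 'rV[R]_m.
Variable J : Omega -> M -> (R -> 'rV[R]_m) -> set R.
Variable phi : R -> Omega -> M -> (R -> 'rV[R]_m) -> M.
Hypothesis f_foot : forall i w x, foot (f i (w, x)) = x.
Hypothesis f_continuous : forall i, continuous (f i).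
Hypothesis sigma_flow : continuous_flow sigma.
Hypothesis U_compact : compact U.
Hypothesis phi_solution : solution_map sigma f U J phi.
Implicit Types (w : Omega) (x : M) (u : R -> 'rV[R]_m).
Notation mu := (@lebesgue_measure R).

Lemma flow_near (w : Omega) (t : R) (P : set Omega) : nbhs (sigma t w) P ->
  exists2 e : R, 0 < e & \forall w' \near w, forall s, `|s - t| < e -> P (sigma s w').
Proof.
move=> nP; have [cs _ _] := sigma_flow.
have [[N1 N2] /= [nN1 nN2] H] : nbhs (t, w) [set p : R * Omega | P (sigma p.1 p.2)].
  exact: (cs (t, w) P nP).
have /nbhs_ballP[e /= e0 eH] := nN1.
exists e => //; apply: filterS nN2 => w' nw' s se.
by apply: (H (s, w')); split=> //=; apply: eH; rewrite /ball /= distrC.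
Qed.

(** All solutions starting near (w0, x0) exist on a common interval [0, t0] and
    stay there in a fixed closed ball of a chart, with a common Lipschitz
    constant. *)
Lemma local_bounds w0 x0 u c : control U u -> charts A c -> cdom c x0 ->
  exists t0 r K : R, [/\ 0 < t0, 0 <= K,
    forall v, `|v - cmap c x0| <= r -> cdom c (cinv c v) /\ cmap c (cinv c v) = v &
    \forall p \near (w0, x0), cdom c p.2 /\
      (forall t, 0 <= t <= t0 -> [/\ J p.1 p.2 u t, cdom c (phi t p.1 p.2 u) &
         `|cmap c (phi t p.1 p.2 u) - cmap c x0| <= r]) /\
      (forall s t, 0 <= s -> s <= t -> t <= t0 ->
         `|cmap c (phi t p.1 p.2 u) - cmap c (phi s p.1 p.2 u)| <= K * (t - s))].
Proof.
move=> cu hc cx0; have [_ Uu] := cu.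
have [K K0 [[N1 N2] /= [nN1 nN2] HK]] :=
  rhs_bounded_near sigma f_foot f_continuous U_compact w0 hc cx0.
have /nbhs_ballP[r1 /= r10 r1H] := chart_inv_near cx0 nN2.
have [|e e0 eH] := @flow_near w0 0 N1; first by rewrite (flow0 sigma_flow).
pose r := r1 / 2.
have r0 : 0 < r by rewrite divr_gt0.
have K1 : 0 < K + 1 by lra.
pose t0 := Num.min (e / 2) (r / (2 * (K + 1))).
have rK0 : 0 < r / (2 * (K + 1)) by rewrite divr_gt0 // mulr_gt0.
have t00 : 0 < t0 by rewrite lt_min rK0 divr_gt0.
have t0e : t0 < e.
  by rewrite /t0; case: (leP (e / 2) (r / (2 * (K + 1)))) => h; lra.
have Kt0 : K * t0 < r / 2.
  have : t0 <= r / (2 * (K + 1)) by rewrite /t0 ge_min lexx orbT.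
  rewrite ler_pdivlMr ?mulr_gt0 //; lra.
have invr v : `|v - cmap c x0| <= r ->
    [/\ cdom c (cinv c v), cmap c (cinv c v) = v & N2 (cinv c v)].
  move=> vr; apply: r1H; rewrite -ball_normE /= distrC; apply: le_lt_trans vr _.
  by rewrite /r; lra.
exists t0, r, K; split=> //; first by move=> v /invr[].
have n1 : \forall p \near (w0, x0), forall s, `|s - 0| < e -> N1 (sigma s p.1).
  exact: cvg_fst eH.
have n2 : \forall p \near (w0, x0), cdom c p.2 /\ `|cmap c p.2 - cmap c x0| < r / 2.
  suff h : \forall x \near x0, cdom c x /\ `|cmap c x - cmap c x0| < r / 2.
    exact: cvg_snd h.
  apply: (chart_near (P := fun v => `|v - cmap c x0| < r / 2)) => //.
  apply/nbhs_ballP; exists (r / 2) => /=; first by lra.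
  by move=> v; rewrite -ball_normE /= distrC.
apply: filterS2 n1 n2 => -[w x] /= N1w [cx cxr]; split=> //.
pose g t := cmap c (phi t w x u).
pose P t := [/\ J w x u t, cdom c (phi t w x u) & `|g t - cmap c x0| < r].
have sol := phi_sol phi_solution w x cu.
have lip s t : 0 <= s -> s <= t -> t <= t0 -> (forall q, s <= q <= t -> P q) ->
    `|g t - g s| <= K * (t - s).
  move=> s0 st tt0 HP; apply: (solution_lip sol Uu hc st K0).
    by move=> q /HP[].
  move=> q sqt Uq; have [_ cq gq] := HP q sqt.
  have [_ _] := invr _ (ltW gq); rewrite /g cmapK ?inE // => N2q.
  apply: (HK (_, _)) Uq => //=; split=> //; apply: N1w.
  by rewrite subr0 ger0_norm; move: sqt; lra.
(* The solution cannot leave the ball before t0 by the Lipschitz estimate. It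
   cannot stop either: its left limit q at t lies in the chart, and pasting it
   with the solution starting at q gives, by maximality, a value at t. *)
have allP : forall t, 0 <= t <= t0 -> P t.
  apply: real_induction.
  - split; first exact: (J0 phi_solution).
      by rewrite (phi0 phi_solution).
    by rewrite /g (phi0 phi_solution) //; lra.
  - move=> t /andP[t_ge0 tt0] HP; have [|Jt ct gt] := HP t; first by rewrite t_ge0 lexx.
    have [[oJ _] _ cphi _ _] := sol.
    have m1 : \forall s \near t, J w x u s by apply: open_nbhs_nbhs; split.
    have m2 : \forall s \near t, cdom c (phi s w x u) /\ `|g s - cmap c x0| < r.
      have ncg : \forall y \near phi t w x u, cdom c y /\ `|cmap c y - cmap c x0| < r.
        apply: (chart_near (P := fun v => `|v - cmap c x0| < r)) => //.
        apply/nbhs_ballP; exists (r - `|g t - cmap c x0|) => /=; first by rewrite subr_gt0.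
        move=> v; rewrite -ball_normE /= distrC => h.
        by apply: le_lt_trans (ler_distD (g t) _ _) _; rewrite -ltrBrDr.
      exact: (cphi t (mem_set Jt) _ ncg).
    have m3 : nbhs t [set s | P s].
      by apply: filterS2 m1 m2 => s Js [cs gs]; split.
    have /nbhs_ballP[dl /= dl0 dlH] := m3.
    exists dl => // s /andP[ts sdl]; apply: dlH; rewrite /ball /= distrC ger0_norm; lra.
  - move=> t /andP[t_gt0 tt0] HP.
    have lipt s s' : 0 <= s -> s <= s' -> s' < t -> `|g s' - g s| <= K * (s' - s).
      move=> s0 ss' s't; apply: lip => //; first lra.
      by move=> q sq; apply: HP; move: sq; lra.
    have [l Hl] := @lip_left_limit R d g 0 t K t_gt0 K0 lipt.
    have lr : `|l - cmap c x0| < r.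
      have h0 := Hl 0 ltac:(by rewrite lexx).
      have h1 : K * (t - 0) <= K * t0 by rewrite ler_wpM2l // subr0.
      move: h0; rewrite /g (phi0 phi_solution) // => h0.
      by apply: le_lt_trans (ler_distD (cmap c x) _ _) _; lra.
    have [cl cinvl _] := invr _ (ltW lr).
    pose u' s := u (s + t).
    have cu' : control U u' by exact: control_shift.
    have [|||_ h] := @phi_glue _ _ _ _ _ _ _ f _ _ _ f_foot f_continuous sigma_flow
      U_compact phi_solution w x u u' t (cinv c l) cu cu' (ltW t_gt0).
    + by move=> s st; have [] := HP s st.
    + by move=> h; move: t_gt0; rewrite h ltxx.
    + set z := (z in locally_lip _ z).
      have zt : z t = cinv c l by rewrite /z ltxx subrr (phi0 phi_solution).
      have zs s : s < t -> z s = phi s w x u by rewrite /z => ->.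
      have cz s : 0 <= s <= t -> cdom c (z s).
        case/andP=> s0; rewrite le_eqVlt => /predU1P[->|st]; first by rewrite zt.
        by rewrite zs //; have [] := HP s ltac:(by rewrite s0).
      have zl s s' : 0 <= s -> s <= s' -> s' <= t ->
          `|cmap c (z s') - cmap c (z s)| <= K * (s' - s).
        move=> s0 ss'; rewrite le_eqVlt => /predU1P[s't|s't].
          move: ss'; rewrite {}s't le_eqVlt => /predU1P[->|st].
            by rewrite !subrr normr0 mulr0.
          by rewrite zt cinvl zs // Hl // s0.
        by rewrite !zs //; [exact: lipt|exact: le_lt_trans s't].
      apply: (@locally_lip_chart _ _ _ _ c) => //=; first by rewrite zt.
      exists t, K; split=> // s s' st s't; rewrite !ltr_norml => sd s'd; split.
        by apply: cz; lra.
      have [ss'|s's] := leP s s'.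
        by rewrite distrC [X in _ * X]distrC [X in _ * X]ger0_norm ?subr_ge0 // zl //; lra.
      by rewrite [X in _ * X]ger0_norm ?subr_ge0 ?(ltW s's) // zl //; lra.
    + have [] := h 0 (lexx 0) (J0 phi_solution _ _ cu').
      rewrite (_ : (fun s => if s < t then u s else u' (s - t)) = u); last first.
        by apply/funext => s; rewrite /u' subrK; case: ifP.
      rewrite add0r (phi0 phi_solution) // => Jt phit.
      by split=> //; rewrite /g phit // cinvl.
split; first by move=> t /allP[Jt ct gt]; split=> //; exact: ltW.
by move=> s t s0 st tt0; apply: lip => // q /andP[sq qt]; apply: allP; lra.
Qed.

End LocalExistence.

(** * Local continuous dependence on the initial point *)

Lemma ltr_dist_between (R : realDomainType) (a b r t h : R) :
  a <= r <= b -> `|a - t| < h -> `|b - t| < h -> `|r - t| < h.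
Proof. by rewrite !ltr_norml; lra. Qed.

Lemma norm_perturb (R : realType) (V : normedModType R) (y1 y2 q1 q2 h1 h2 : V) :
  `|(y1 - q1) - (y2 - q2)| <=
    `|(h1 - q1) - (h2 - q2)| + (`|h1 - y1| + `|h2 - y2|).
Proof.
have subrACA (a b a' b' : V) : (a - b) - (a' - b') = (a - a') - (b - b').
  by rewrite opprD addrACA -opprD.
have -> : (y1 - q1) - (y2 - q2) =
    ((h1 - q1) - (h2 - q2)) + ((h2 - y2) - (h1 - y1)).
  rewrite !(subrACA _ q1) (subrACA h2) [RHS]addrC [RHS]addrA; congr (_ - _).
  by rewrite [RHS]addrAC addrA subrK subrr add0r opprB.
apply: le_trans (ler_normD _ _) _; rewrite lerD2l [leRHS]addrC.
exact: ler_normB.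
Qed.

Lemma ultra_compact_cvg (T : Type) (V : topologicalType) (h : T -> V)
    (G : set_system T) (C : set V) :
  UltraFilter G -> compact C -> G (h @^-1` C) -> exists2 v, C v & h @ G --> v.
Proof.
move=> GU cC GC; have GP := @ultra_proper _ _ GU.
have [v [Cv clv]] := cC (h @ G) (fmap_proper_filter h GP) GC.
exists v => // N nN; have [//|GN] := in_ultra_setVsetC (h @^-1` N) GU.
by have [p [nNp Np]] := clv (~` N) N GN nN; case: (nNp Np).
Qed.

Lemma is_derive_scale_vec (R : realType) (V : normedModType R) (v : R -> R)
    (t a : R) (F : V) : is_derive t (1 : R) v a ->
  is_derive t (1 : R) (fun r => v r *: F) (a *: F).
Proof.
move=> /is_deriveP dv; apply/is_deriveP => e e0.
have F1 : 0 < `|F| + 1 by rewrite ltr_wpDl.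
have [dl dl0 H] := dv _ (divr_gt0 e0 F1).
exists dl => // s /H h; rewrite scalerA -!scalerBl normrZ.
apply: le_trans (ler_wpM2r (normr_ge0 _) h) _.
rewrite mulrAC ler_wpM2r // mulrAC ler_pdivrMr // ler_pM2l //.
by rewrite lerDl.
Qed.

Section LocalContinuity.
Context {R : realType} {Omega M : topologicalType} {d m : nat}.
Variables (A : smooth_atlas (R := R) M d) (sigma : R -> Omega -> Omega).
Variable f : 'I_m.+1 -> Omega * M -> tangent_bundle A.
Variable U : set 'rV[R]_m.
Variable J : Omega -> M -> (R -> 'rV[R]_m) -> set R.
Variable phi : R -> Omega -> M -> (R -> 'rV[R]_m) -> M.
Hypothesis f_foot : forall i w x, foot (f i (w, x)) = x.
Hypothesis f_continuous : forall i, continuous (f i).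
Hypothesis sigma_flow : continuous_flow sigma.
Hypothesis U_compact : compact U.
Hypothesis phi_solution : solution_map sigma f U J phi.
Implicit Types (w : Omega) (x : M) (u : R -> 'rV[R]_m).
Notation mu := (@lebesgue_measure R).

Lemma control_antiderivative u : control U u ->
  exists (B : R) (v : 'I_m -> R -> R), [/\ 0 <= B,
    {ae mu, forall t, forall i, `|u t ord0 i| <= B},
    forall i s t, 0 <= s -> s <= t -> `|v i t - v i s| <= B * (t - s) &
    {ae mu, forall t : R, 0 < t -> forall i, is_derive t (1 : R) (v i) (u t ord0 i)}].
Proof.
move=> /(controlP U_compact)[mu_ Uu].
have [B B0 UB] := compact_norm_bound U_compact.
have uB : {ae mu, forall t, forall i, `|u t ord0 i| <= B}.
  by apply: ae_sub Uu => t /UB ut i; rewrite (le_trans _ ut) // row_norm_ge.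
have H (i : 'I_m) : exists v : R -> R,
    (forall s t, 0 <= s -> s <= t -> `|v t - v s| <= B * (t - s)) /\
    {ae mu, forall t : R, 0 < t -> is_derive t (1 : R) v (u t ord0 i)}.
  by apply: bounded_antiderivative => //; apply: ae_sub uB => t; apply.
have [v Hv] := choice H.
exists B, v; split=> //; first by move=> i; have [] := Hv i.
apply: (@ae_sub _ (fun t : R => forall i, 0 < t -> is_derive t (1 : R) (v i) (u t ord0 i))).
  by move=> t h t0 i; exact: h.
have FF : Filter (almost_everywhere mu) by exact: ae_filter_ringOfSetsType.
apply: (@filter_forall _ _ (fun (i : 'I_m) (t : R) =>
  0 < t -> is_derive t (1 : R) (v i) (u t ord0 i)) _ FF).
by move=> i; have [] := Hv i.
Qed.

(** The primitive r |-> r F_0 + sum_i v_i(r) F_i of the right-hand side with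
    constant fields F, for antiderivatives v_i of the controls. *)
Definition frozen_primitive (v : 'I_m -> R -> R) (F : 'I_m.+1 -> 'rV[R]_d) (r : R) :=
  r *: F ord0 + \sum_(i < m) v i r *: F (lift ord0 i).

Lemma is_derive_frozen_primitive v F (t : R) (a : 'I_m -> R) :
  (forall i, is_derive t (1 : R) (v i) (a i)) ->
  is_derive t (1 : R) (frozen_primitive v F)
    (F ord0 + \sum_(i < m) a i *: F (lift ord0 i)).
Proof.
move=> dv; rewrite -[F ord0]scale1r.
have -> : frozen_primitive v F = (fun r : R => r *: F ord0) +
    \sum_(i < m) (fun r : R => v i r *: F (lift ord0 i)).
  by apply/funext => r; rewrite /frozen_primitive fct_sumE.
apply: is_deriveD; first exact: (is_derive_scale_vec (F ord0) (is_derive_id t 1)).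
exact: (is_derive_sum (fun i => is_derive_scale_vec (F (lift ord0 i)) (dv i))).
Qed.

Lemma frozen_primitive_lip v F (B : R) s t : s <= t ->
  (forall i, `|v i t - v i s| <= B * (t - s)) ->
  `|frozen_primitive v F t - frozen_primitive v F s| <=
    (`|F ord0| + \sum_(i < m) B * `|F (lift ord0 i)|) * (t - s).
Proof.
move=> st vB; rewrite /frozen_primitive opprD addrACA -scalerBl -sumrB.
apply: le_trans (ler_normD _ _) _; rewrite mulrDl; apply: lerD.
  by rewrite normrZ ger0_norm ?subr_ge0 // mulrC.
apply: le_trans (ler_norm_sum _ _ _) _; rewrite mulr_suml; apply: ler_sum => i _.
by rewrite -scalerBl normrZ mulrAC ler_wpM2r.
Qed.

(** A solution along which the fields differ from the constants F by at most e
    has almost the increments of the frozen primitive. *)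
Lemma solution_close w u I z c s s' (v : 'I_m -> R -> R) F (B K e : R) :
  solution sigma f w u I z -> charts A c -> 0 <= s -> s <= s' -> 0 <= B -> 0 <= e ->
  {ae mu, forall t, forall i, `|u t ord0 i| <= B} ->
  (forall i s t, 0 <= s -> s <= t -> `|v i t - v i s| <= B * (t - s)) ->
  {ae mu, forall t : R, 0 < t -> forall i, is_derive t (1 : R) (v i) (u t ord0 i)} ->
  (forall r r', s <= r -> r <= r' -> r' <= s' ->
     `|cmap c (z r') - cmap c (z r)| <= K * (r' - r)) ->
  (forall r, s <= r <= s' -> [/\ I r, cdom c (z r) &
     forall i, `|vcomp (f i (sigma r w, z r)) c - F i| <= e]) ->
  `|(cmap c (z s') - frozen_primitive v F s') - (cmap c (z s) - frozen_primitive v F s)| <=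
     e * (1 + m%:R * B) * (s' - s).
Proof.
move=> sol hc s0 ss' B0 e0 uB vB dv lipz HI.
have subrACA (a b a' b' : 'rV[R]_d) : (a - b) - (a' - b') = (a - a') - (b - b').
  by rewrite opprD addrACA -opprD.
pose C := `|F ord0| + \sum_(i < m) B * `|F (lift ord0 i)|.
apply: (@abs_continuous_lip _ _ (fun r => cmap c (z r) - frozen_primitive v F r)) => //.
- by rewrite mulr_ge0 // addr_ge0 // mulr_ge0.
- apply: (@abs_continuous_of_lip _ _ _ _ _ (K + C)) => r r' sr rr' r's'.
  rewrite /= subrACA mulrDl.
  apply: le_trans (ler_normB _ _) (lerD _ _); first exact: lipz.
  by apply: frozen_primitive_lip => // i; apply: vB => //; exact: le_trans sr.
- have [_ _ _ _ dz] := sol.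
  apply: ae_sub (ae_and dz (ae_and dv uB)) => r [dzr [dvr ur]] /andP[sr rs'].
  have [|Ir cr Fr] := HI r; first by rewrite !ltW.
  exists (rhs sigma f w u c r (z r) -
    (F ord0 + \sum_(i < m) u r ord0 i *: F (lift ord0 i))).
    apply: is_deriveB; first exact: dzr.
    by apply: is_derive_frozen_primitive => i; apply: dvr; exact: le_lt_trans sr.
  rewrite /rhs opprD addrACA -sumrB mulrDr mulr1.
  apply: le_trans (ler_normD _ _) (lerD (Fr _) _).
  apply: le_trans (ler_norm_sum _ _ _) _.
  rewrite (_ : e * (m%:R * B) = \sum_(i < m) B * e); last first.
    by rewrite sumr_const card_ord -[RHS]mulr_natl [e * _]mulrC -mulrA.
  apply: ler_sum => i _; rewrite -scalerBr normrZ; exact: ler_pM.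
Qed.

Lemma row_closed_ball_compact (v0 : 'rV[R]_d) (r : R) :
  compact [set v : 'rV[R]_d | `|v - v0| <= r].
Proof.
apply: bounded_closed_compact.
  exists (`|v0| + r); split; first by rewrite num_real.
  move=> x xr v /= vr; apply: le_trans (ltW xr).
  by have := ler_normD (v - v0) v0; rewrite subrK; move: vr; lra.
rewrite (_ : [set v | _] = (fun v => `|v - v0|) @^-1` [set x | x <= r]) //.
apply: closed_comp => [v _|]; last exact: closed_le.
apply: continuous_comp; last exact: norm_continuous.
by apply: continuousB; [exact: cvg_id|exact: cst_continuous].
Qed.

(** A pointwise limit y, along a filter G finer than the neighbourhoods of
    (w0, x0), of uniformly Lipschitz solutions satisfies the equation at each t
    where the antiderivatives v_i have derivative u_i(t). *)
Lemma limit_is_derive u c w0 x0 (t0 K B : R) (v : 'I_m -> R -> R)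
    (G : set_system (Omega * M)) (y : R -> 'rV[R]_d) (t : R) :
  control U u -> charts A c -> 0 <= K -> 0 <= B ->
  {ae mu, forall t, forall i, `|u t ord0 i| <= B} ->
  (forall i s t, 0 <= s -> s <= t -> `|v i t - v i s| <= B * (t - s)) ->
  {ae mu, forall t : R, 0 < t -> forall i, is_derive t (1 : R) (v i) (u t ord0 i)} ->
  ProperFilter G -> (forall P, nbhs (w0, x0) P -> G P) ->
  G [set p |
    (forall t, 0 <= t <= t0 -> J p.1 p.2 u t /\ cdom c (phi t p.1 p.2 u)) /\
    (forall s t, 0 <= s -> s <= t -> t <= t0 ->
      `|cmap c (phi t p.1 p.2 u) - cmap c (phi s p.1 p.2 u)| <= K * (t - s))] ->
  (forall t e, 0 <= t <= t0 -> 0 < e ->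
     G [set p | `|cmap c (phi t p.1 p.2 u) - y t| < e]) ->
  cdom c (cinv c (y t)) -> cmap c (cinv c (y t)) = y t -> 0 < t < t0 ->
  (forall i, is_derive t (1 : R) (v i) (u t ord0 i)) ->
  is_derive t (1 : R) y (rhs sigma f w0 u c t (cinv c (y t))).
Proof.
move=> cu hc K0 B0 uB vB dv GP nG Ggood Gy cx2 cx2E /andP[t_gt0 tt0] dvt.
pose x2 t := cinv c (y t); rewrite -/(x2 t) in cx2 cx2E *.
pose h t (p : Omega * M) := cmap c (phi t p.1 p.2 u).
have tri (a b e : 'rV[R]_d) : `|a - e| <= `|a - b| + `|b - e| by exact: ler_distD.
have Gpick (P : set (Omega * M)) : G P -> exists p, P p by exact: filter_ex.
have tI : 0 <= t <= t0 by rewrite !ltW.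
pose F i := vcomp (f i (sigma t w0, x2 t)) c.
pose q := frozen_primitive v F.
(* q freezes the fields at (sigma t w0, y t); it suffices that y - q has
   derivative 0 at t *)
suff dyq : is_derive t (1 : R) (fun r => y r - q r) 0.
  rewrite -[rhs _ _ _ _ _ _ _]add0r.
  rewrite (_ : y = (fun r => y r - q r) + q); last first.
    by apply/funext => r'; rewrite fctE subrK.
  apply: is_deriveD => //.
  exact: (is_derive_frozen_primitive F dvt).
apply/is_deriveP => e e0; have mB0 : 0 <= m%:R * B by rewrite mulr_ge0.
pose e1 := e / (1 + m%:R * B).
have e10 : 0 < e1 by rewrite divr_gt0 //; lra.
have nF : \forall p \near (sigma t w0, x2 t), forall i, `|vcomp (f i p) c - F i| <= e1.
  have FF : Filter (nbhs (sigma t w0, x2 t)) by exact: nbhs_filter.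
  apply: (@filter_forall _ _ (fun i p => `|vcomp (f i p) c - F i| <= e1) _ FF) => i.
  apply: (@vcomp_near _ _ _ A _ (f i) (sigma t w0, x2 t) c (fun v => `|v - F i| <= e1) hc).
  - exact: f_continuous.
  - by rewrite f_foot.
  - apply/nbhs_ballP; exists e1 => //= v'; rewrite -ball_normE /= distrC; exact: ltW.
have [[N1 N2] /= [nN1 nN2] HF] := nF.
have [h1 h10 nW] := flow_near sigma_flow nN1.
have := chart_inv_near cx2 nN2; rewrite cx2E => /nbhs_ballP[rho /= rho0 Hrho].
have K1 : 0 < K + 1 by lra.
pose h2 := rho / (2 * (K + 1)).
have h20 : 0 < h2 by rewrite divr_gt0 // mulr_gt0.
have Kh2 : K * h2 < rho / 2.
  have E : h2 * (2 * (K + 1)) = rho by rewrite divfK // mulf_neq0 // gt_eqF.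
  lra.
pose dl := Num.min (Num.min h1 h2) (Num.min t (t0 - t)).
have dl0 : 0 < dl by rewrite !lt_min h10 h20 t_gt0 subr_gt0.
have step a b : a <= b -> `|a - t| < dl -> `|b - t| < dl ->
    `|(y b - q b) - (y a - q a)| <= e * (b - a).
  rewrite !lt_min => ab /andP[/andP[ah1 ah2] /andP[at_ at0]]
    /andP[/andP[bh1 bh2] /andP[bt bt0]].
  have a0 : 0 <= a by move: at_; rewrite ltr_distl subrr => /andP[/ltW].
  have bt0' : b <= t0 by move: bt0; rewrite ltr_distl => /andP[_]; rewrite addrC subrK => /ltW.
  have aI : 0 <= a <= t0 by rewrite a0 (le_trans ab).
  have bI : 0 <= b <= t0 by rewrite (le_trans a0).
  apply/ler_addgt0Pr => e' e'0.
  have e20 : 0 < e' / 2 by rewrite divr_gt0.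
  have rho20 : 0 < rho / 2 by rewrite divr_gt0.
  have nW' : \forall p \near (w0, x0), forall r', `|r' - t| < h1 -> N1 (sigma r' p.1).
    exact: cvg_fst nW.
  have [p [[[p1 p2] p3] [[pg pl] pW]]] := Gpick _ (filterI (filterI (filterI
    (Gy a (e' / 2) aI e20) (Gy b (e' / 2) bI e20)) (Gy t (rho / 2) tI rho20))
    (filterI Ggood (nG _ nW'))).
  rewrite /= in p1 p2 p3 pW.
  have near_t r' : a <= r' <= b -> `|r' - t| < h1 /\ `|r' - t| < h2.
    by move=> rab; split; exact: (ltr_dist_between rab).
  have hr r' : a <= r' <= b -> `|h r' p - y t| < rho.
    move=> rab; have [_ rh2] := near_t _ rab; case/andP: rab => ar rb.
    have le1 : `|h r' p - h t p| <= K * `|r' - t|.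
      have [rt|tr] := leP r' t.
        rewrite distrC [X in _ * X]distrC [X in _ * X]ger0_norm ?subr_ge0 //.
        by apply: pl => //; [exact: le_trans ar|exact: ltW].
      rewrite [X in _ * X]ger0_norm ?subr_ge0 ?(ltW tr) //.
      by apply: pl => //; [exact: ltW|exact: ltW|exact: le_trans bt0'].
    have le2 : K * `|r' - t| <= K * h2 by rewrite ler_wpM2l // ltW.
    apply: le_lt_trans (tri _ (h t p) _) _; rewrite [rho]splitr ltrD //.
    exact: le_lt_trans (le_trans le1 le2) Kh2.
  have sol := phi_sol phi_solution p.1 p.2 cu.
  have close := @solution_close p.1 u (J p.1 p.2 u) (fun t => phi t p.1 p.2 u) c a b v F
    B K e1 sol hc a0 ab B0 (ltW e10) uB vB dv.
  have {close} : `|(h b p - q b) - (h a p - q a)| <= e1 * (1 + m%:R * B) * (b - a).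
    apply: close => [r1 r2 ar1 r12 r2b|r1 ar1b].
      by apply: pl => //; [exact: le_trans ar1|exact: le_trans bt0'].
    have [|Jr1 cr1] := pg r1.
      by case/andP: ar1b => ar1 r1b; rewrite (le_trans a0 ar1) (le_trans r1b).
    split=> // i; have [rh1 _] := near_t _ ar1b.
    have [_ _] := Hrho (h r1 p) ltac:(by rewrite -ball_normE /= distrC hr).
    rewrite /h (cmapK (mem_set cr1)) => N2r.
    by apply: (HF (sigma r1 p.1, phi r1 p.1 p.2 u)); split=> //=; exact: pW.
  rewrite divfK ?gt_eqF ?ltr_wpDr //.
  move=> close; apply: le_trans (norm_perturb _ _ (q b) (q a) (h b p) (h a p)) _.
  by rewrite lerD // [e']splitr lerD // ltW.
exists dl => // b bt; rewrite scaler0 subr0.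
have tdl : `|t - t| < dl by rewrite subrr normr0.
have [bt'|tb] := leP b t.
  rewrite distrC [X in _ * X]distrC [X in _ * X]ger0_norm ?subr_ge0 //.
  exact: step.
by rewrite [X in _ * X]ger0_norm ?subr_ge0 ?(ltW tb) //; apply: step => //; exact: ltW.
Qed.

Lemma local_continuity w0 x0 u : control U u ->
  exists2 t0 : R, 0 < t0 & forall s, 0 <= s < t0 -> J w0 x0 u s /\
    forall N, nbhs (phi s w0 x0 u) N ->
    \forall p \near (w0, x0), J p.1 p.2 u s /\ N (phi s p.1 p.2 u).
Proof.
move=> cu; have [c hc cx0] := charts_cover A x0.
have [t0 [r [K [t00 K0 invr nb]]]] := local_bounds f_foot f_continuous sigma_flow
  U_compact phi_solution w0 cu hc cx0.
set good := (fun p : Omega * M => _) in nb.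
exists t0 => // s /andP[s0 st0]; split.
  have [_ [H _]] := nbhs_singleton nb.
  by have [] := H s ltac:(by rewrite s0 ltW).
move=> N nN; apply: contrapT => nearN.
(* An ultrafilter finer than the neighbourhoods of (w0, x0), but containing the
   set of initial points that violate the conclusion. *)
pose Bad := [set p : Omega * M | ~ (J p.1 p.2 u s /\ N (phi s p.1 p.2 u))].
have PF : ProperFilter (within Bad (nbhs (w0, x0))).
  split; last exact: within_filter.
  rewrite /within /= => h; apply: nearN; move: h; apply: filterS => p h.
  by apply: contrapT => /h.
have [G [GU FG]] := ultraFilterLemma PF.
have GP : ProperFilter G := @ultra_proper _ _ GU.
have nG P : nbhs (w0, x0) P -> G P.
  by move=> nP; apply: FG; rewrite /within /=; apply: filterS nP => p.
have GBad : G Bad by apply: FG; rewrite /within /=; exact: nearW.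
have Ggood : G good by exact: nG.
pose h t (p : Omega * M) := cmap c (phi t p.1 p.2 u).
have ylim (t : R) : exists v : 'rV[R]_d, 0 <= t <= t0 -> `|v - cmap c x0| <= r /\ h t @ G --> v.
  have [tt0|] := boolP (0 <= t <= t0); last by exists 0.
  have [|v vr hv] := ultra_compact_cvg (h := h t) GU (@row_closed_ball_compact (cmap c x0) r).
    by apply: filterS Ggood => p [_ [H _]]; have [] := H t tt0.
  by exists v.
have [y Hy] := choice ylim.
have tri (a b e : 'rV[R]_d) : `|a - e| <= `|a - b| + `|b - e| by exact: ler_distD.
have Gy t e : 0 <= t <= t0 -> 0 < e -> G [set p | `|h t p - y t| < e].
  move=> /Hy[_ /cvgrPdist_lt hv] e0; have := hv e e0.
  by apply: filterS => p; rewrite distrC.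
have Gpick (P : set (Omega * M)) : G P -> exists p, P p by exact: filter_ex.
have ylip t t' : 0 <= t -> t <= t' -> t' <= t0 -> `|y t' - y t| <= K * (t' - t).
  move=> t_ge0 tt' t't0; apply/ler_addgt0Pr => e e0.
  have e20 : 0 < e / 2 by rewrite divr_gt0.
  have [||p [[p1 p2] [_ [_ p3]]]] := Gpick _ (filterI (filterI
    (Gy t (e / 2) _ e20) (Gy t' (e / 2) _ e20)) Ggood); try lra.
  have p4 : `|h t' p - h t p| <= K * (t' - t) by exact: p3.
  rewrite /= in p1 p2.
  have q1 := tri (y t') (h t' p) (y t); have q2 := tri (h t' p) (h t p) (y t).
  have q3 : `|y t' - h t' p| < e / 2 by rewrite distrC.
  lra.
have y0 : y 0 = cmap c x0.
  apply/eqP; rewrite -subr_eq0 -normr_le0; apply/ler_addgt0Pr => e e0; rewrite add0r.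
  have e20 : 0 < e / 2 by rewrite divr_gt0.
  have nc : \forall p \near (w0, x0), cdom c p.2 /\ `|cmap c p.2 - cmap c x0| < e / 2.
    suff nc : \forall x \near x0, cdom c x /\ `|cmap c x - cmap c x0| < e / 2.
      exact: cvg_snd nc.
    apply: (chart_near (P := fun v => `|v - cmap c x0| < e / 2)) => //.
    apply/nbhs_ballP; exists (e / 2) => //= v.
    by rewrite -ball_normE /= distrC.
  have [|p [p1 [_ p2]]] := Gpick _ (filterI (Gy 0 (e / 2) _ e20) (nG _ nc)).
    by rewrite lexx ltW.
  move: p1; rewrite /= /h (phi0 phi_solution) // => p1.
  have q1 := tri (y 0) (cmap c p.2) (cmap c x0).
  have q2 : `|y 0 - cmap c p.2| < e / 2 by rewrite distrC.
  lra.
have [B [v [B0 uB vB dv]]] := control_antiderivative cu.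
pose x2 t := cinv c (y t).
have x2c t : 0 <= t <= t0 -> cdom c (x2 t) /\ cmap c (x2 t) = y t.
  by move=> /Hy[yr _]; exact: invr.
have key (t : R) : 0 < t < t0 -> (forall i, is_derive t (1 : R) (v i) (u t ord0 i)) ->
    is_derive t (1 : R) y (rhs sigma f w0 u c t (x2 t)).
  move=> /andP[t_gt0 tt0] dvt; have [|cx2 cx2E] := x2c t; first by rewrite !ltW.
  apply: (@limit_is_derive u c w0 x0 t0 K B v G y t) => //.
  - by apply: filterS Ggood => p [_ [H1 H2]]; split=> // t' /H1[].
  - by rewrite t_gt0.
pose J2 := [set t : R | - t0 < t < t0].
have x2_lip t (S : set R) : 0 <= t < t0 -> S t ->
    (exists2 e, 0 < e & forall s, S s -> `|s - t| < e -> 0 <= s <= t0) ->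
    locally_lip A x2 S t.
  move=> /andP[t_ge0 tt0] St [e e0 He]; have [|cx2 _] := x2c t; first by rewrite t_ge0 ltW.
  apply: (locally_lip_chart hc cx2 St); exists e, K; split=> // a b Sa Sb ae be.
  have aI := He _ Sa ae; have bI := He _ Sb be.
  have [ca caE] := x2c a aI; have [_ cbE] := x2c b bI; split=> //.
  rewrite caE cbE; have [ab|ba] := leP a b.
    by rewrite distrC [X in _ * X]distrC [X in _ * X]ger0_norm ?subr_ge0 // ylip //; lra.
  by rewrite [X in _ * X]ger0_norm ?subr_ge0 ?(ltW ba) // ylip //; lra.
have solphi := phi_sol phi_solution w0 x0 cu.
have [[oJ1 iJ1] J10 _ _ _] := solphi.
have x20 : x2 0 = x0 by rewrite /x2 y0 cmapK //; exact: mem_set.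
(* y is only known for t >= 0: the solution through x0 completes it *)
have sol : solution sigma f w0 (fun t => if t < 0 then u t else u t)
    [set t | if t < 0 then J w0 x0 u t else J2 t]
    (fun t => if t < 0 then phi t w0 x0 u else x2 t).
  apply: (solution_glue f_foot) => //.
  - by move=> t /andP[h1 h2]; have := le_lt_trans h1 h2; rewrite ltxx.
  - rewrite (_ : J2 = `](- t0), t0[%classic); first exact: interval_open.
    by apply/seteqP; split=> t; rewrite /J2 /= in_itv.
  - by move=> a b aJ bJ t tab; rewrite /J2 /= in aJ bJ *; lra.
  - by rewrite /J2 /=; lra.
  - by move=> t _ Jt;
      exact: (phi_locally_lip f_foot f_continuous sigma_flow U_compact phi_solution).
  - move=> t t_gt0; rewrite /J2 /= => /andP[_ tt0]; apply: x2_lip => //; first by rewrite ltW.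
    exists (Num.min t (t0 - t)); first by rewrite lt_min t_gt0 subr_gt0.
    by move=> a _; rewrite lt_min !ltr_norml; lra.
  - apply: (locally_lip_sub ltr01 _ _ (phi_locally_lip f_foot f_continuous sigma_flow
      U_compact phi_solution cu J10)).
      by rewrite ltxx x20 (phi0 phi_solution).
    move=> a _ /= a0; split=> //; case: ltP => // a0'.
    have -> : a = 0 by apply/le_anti; rewrite a0 a0'.
    by rewrite x20 (phi0 phi_solution).
  - apply: x2_lip => //=; first by rewrite lexx.
    by exists t0 => // a /= a0; rewrite subr0 ger0_norm // => at0; rewrite a0 ltW.
  - by apply: ae_sub (solution_trajectory solphi) => t H _; exact: H.
  - apply: ae_sub dv => t dvt t_gt0; rewrite /J2 /= => /andP[_ tt0].
    have [|cx2 cx2E] := x2c t; first by rewrite !ltW.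
    exists c; split=> //.
    have e0 : 0 < Num.min t (t0 - t) by rewrite lt_min t_gt0 subr_gt0.
    apply: (is_derive_near e0 _ (key t _ (dvt t_gt0))); last by rewrite t_gt0.
    move=> a; rewrite lt_min !ltr_norml => ha /=.
    by have [|_ ->] := x2c a; first lra.
have uE : (fun t => if t < 0 then u t else u t) = u.
  by apply/funext => t; rewrite if_same.
rewrite {}uE in sol.
have z0 : (if (0 : R) < 0 then phi 0 w0 x0 u else x2 0) = x0 by rewrite ltxx.
have uniq := phi_unique phi_solution cu sol z0.
have [|_] := uniq s; first by rewrite /= ltNge s0 /= /J2 /=; lra.
rewrite ltNge s0 /= => phisE.
rewrite {}phisE in nN; have sI : 0 <= s <= t0 by rewrite s0 ltW.
have [cx2 cx2E] := x2c s sI.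
have := chart_inv_near cx2 nN; rewrite cx2E => nv.
have [_ hs] := Hy s sI.
have GN : G [set p | [/\ cdom c (cinv c (h s p)), cmap c (cinv c (h s p)) = h s p &
    N (cinv c (h s p))]] by exact: hs _ nv.
have [p [[[_ [pg _]] pB] pN]] := Gpick _ (filterI (filterI Ggood GBad) GN).
have [Jp cp _] := pg s sI; apply: pB; split=> //.
by have [_ _] := pN; rewrite /h (cmapK (mem_set cp)).
Qed.

End LocalContinuity.

(** * Recurrence and reachable sets *)

Section MinimalFlow.
Context {R : realType} {Omega : topologicalType}.
Variable sigma : R -> Omega -> Omega.
Hypothesis Omega_compact : compact [set: Omega].
Hypothesis sigma_flow : continuous_flow sigma.
Hypothesis sigma_minimal : minimal_flow sigma.

(** In a minimal flow on a compact space every omega-limit set is the whole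
    space. *)
Lemma minimal_recurrence (w w' : Omega) (N : set Omega) (T : R) : nbhs w' N ->
  exists t, T <= t /\ N (sigma t w).
Proof.
have [_ _ sD] := sigma_flow.
pose B := [set p : Omega | forall N, nbhs p N -> forall T, exists t, T <= t /\ N (sigma t w)].
suff BT : B = setT.
  have Bw' : B w' by rewrite BT.
  by move=> nN; exact: Bw'.
apply: sigma_minimal.2.
- move=> p clp Q nQ T'; have := nQ; rewrite nbhsE => -[V [oV Vp] VQ].
  have [q [Bq Vq]] := clp V (open_nbhs_nbhs (conj oV Vp)).
  have [t [Tt Vt]] := Bq V (open_nbhs_nbhs (conj oV Vq)) T'.
  by exists t; split=> //; exact: VQ.
- have [p [_ clp]] := Omega_compact
    (fmap_proper_filter (fun t => sigma t w) (@proper_pinfty_nbhs R)) filterT.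
  exists p => Q nQ T'.
  have [|q [[t Tt <-] Qt]] := clp [set sigma t w | t in [set t | T' <= t]] Q _ nQ.
    have nT : \forall t \near +oo, T' <= t by apply: nbhs_pinfty_ge; exact: num_real.
    by apply: filterS nT => t Tt /=; exists t.
  by exists t.
- move=> s p Bp Q nQ T'.
  have nQ' : nbhs p [set q | Q (sigma s q)].
    have [e e0 He] := flow_near sigma_flow nQ.
    by apply: filterS He => q; apply; rewrite subrr normr0.
  have [t [Tt Qt]] := Bp _ nQ' (T' - s).
  by exists (s + t); split; [lra|rewrite sD].
Qed.

End MinimalFlow.

Section ControlSets.
Context {R : realType} {Omega M : topologicalType} {d m : nat}.
Variables (A : smooth_atlas (R := R) M d) (sigma : R -> Omega -> Omega).
Variable f : 'I_m.+1 -> Omega * M -> tangent_bundle A.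
Variable U : set 'rV[R]_m.
Variable J : Omega -> M -> (R -> 'rV[R]_m) -> set R.
Variable phi : R -> Omega -> M -> (R -> 'rV[R]_m) -> M.
Hypothesis f_foot : forall i w x, foot (f i (w, x)) = x.
Hypothesis f_continuous : forall i, continuous (f i).
Hypothesis sigma_flow : continuous_flow sigma.
Hypothesis U_compact : compact U.
Hypothesis phi_solution : solution_map sigma f U J phi.
Implicit Types (w : Omega) (x : M) (u : R -> 'rV[R]_m).
Notation Re := (ext_reach sigma U J phi).

Lemma ext_reachI w x t u : 0 <= t -> control U u -> J w x u t ->
  Re w x (sigma t w, phi t w x u).
Proof. by move=> t0 cu Jt; exists t, u. Qed.

Lemma ext_reach_trans w x w' x' p : Re w x (w', x') -> Re w' x' p -> Re w x p.
Proof.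
move=> [b [u1 [b0 cu1 Jb]]] [-> ->] [t [u2 [t0 cu2 Jt ->]]].
have [u [cu _ /(_ t t0 Jt)[Jtb E]]] := phi_cat f_foot f_continuous sigma_flow
  U_compact phi_solution cu1 cu2 b0 Jb.
exists (t + b), u; split=> //; first exact: addr_ge0.
by rewrite /psi E (flowD sigma_flow).
Qed.

(** Closures of reachable sets are positively invariant, by real induction:
    local_continuity gives the steps to the right, closedness the limits from
    the left. *)
Lemma closure_ext_reach_invariant w1 x1 w x u (t : R) :
  closure (Re w1 x1) (w, x) -> control U u -> 0 <= t -> J w x u t ->
  closure (Re w1 x1) (psi sigma phi t w x u).
Proof.
move=> cl0 cu t0 Jt.
have Js s : 0 <= s <= t -> J w x u s by exact: (J_segment phi_solution cu Jt).
have cphi s : 0 <= s <= t ->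
    psi sigma phi s w x u @[s --> s] --> psi sigma phi s w x u.
  move=> /Js Jss; apply: cvg_pair; first exact: flow_time_continuous.
  by have [_ _ cphi _ _] := phi_sol phi_solution w x cu; exact: cphi (mem_set Jss).
apply: (@real_induction _ (fun s => closure (Re w1 x1) (psi sigma phi s w x u)) 0 t);
  last by rewrite t0 lexx.
- by rewrite /psi (flow0 sigma_flow) (phi0 phi_solution).
- move=> s /andP[s0 st] /(_ s); rewrite s0 lexx => /(_ isT) cls.
  pose u' r := u (r + s); have cu' : control U u' by exact: control_shift.
  have Jss : J w x u s by apply: Js; rewrite s0 ltW.
  have [e e0 He] := local_continuity f_foot f_continuous sigma_flow U_compact
    phi_solution (sigma s w) (phi s w x u) cu'.
  exists e => // r /andP[sr rse]; have [|Jr Hr] := He (r - s); first lra.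
  have [|Jr' Er] := phi_shift f_foot f_continuous sigma_flow U_compact phi_solution
    (t := r - s) cu Jss; first exact: Jr.
  move: Er; rewrite subrK => Er.
  move=> Q [[Q1 Q2] /= [nQ1 nQ2] HQ].
  have nQ2' : nbhs (phi (r - s) (sigma s w) (phi s w x u) u') Q2 by rewrite -Er.
  have nQ1' : nbhs (sigma (r - s) (sigma s w)) Q1 by rewrite -(flowD sigma_flow) subrK.
  have [e' e'0 He'] := flow_near sigma_flow nQ1'.
  have n1 : \forall p \near (sigma s w, phi s w x u),
      forall q : R, `|q - (r - s)| < e' -> Q1 (sigma q p.1) by exact: cvg_fst He'.
  have [[w2 x2] [Rp [/= p1 [Jp p2]]]] := cls _ (filterI n1 (Hr _ nQ2')).
  exists (sigma (r - s) w2, phi (r - s) w2 x2 u'); split.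
    by apply: ext_reach_trans Rp _; apply: ext_reachI => //; lra.
  by apply: HQ; split=> //=; apply: p1; rewrite subrr normr0.
- move=> s /andP[s0 st] Hs Q; rewrite nbhsE => -[V [oV Vs] VQ].
  have nVs : \forall r \near s, V (psi sigma phi r w x u).
    by apply: (cphi s); [rewrite (ltW s0)|exact: open_nbhs_nbhs].
  have /nbhs_ballP[e /= e0 eH] := nVs.
  pose r := Num.max 0 (s - e / 2).
  have [r0 rs rse] : [/\ 0 <= r, r < s & s - r < e].
    by rewrite /r; case: (leP 0 (s - e / 2)) => ?; split; lra.
  have Vr : V (psi sigma phi r w x u).
    by apply: eH; rewrite /ball /= ger0_norm ?subr_ge0 ?(ltW rs).
  have [|p [Rp Vp]] := Hs r _ V (open_nbhs_nbhs (conj oV Vr)); first by rewrite r0.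
  by exists p; split=> //; exact: VQ.
Qed.

End ControlSets.

(** * The control set around the equilibrium *)

Lemma ball_graph_near (R : realType) (Omega M : metricType R) (alpha : Omega -> M)
    (w : Omega) (x : M) (eps : R) : {for w, continuous alpha} ->
  ball (alpha w) eps x -> \forall p \near (w, x), ball (alpha p.1) eps p.2.
Proof.
move=> ca; rewrite ballEmdist /= => wx.
pose e := (eps - mdist (alpha w) x) / 2.
have e0 : 0 < e by rewrite divr_gt0 // subr_gt0.
have n1 : \forall w' \near w, ball (alpha w) e (alpha w').
  by apply: ca; exact: nbhsx_ballx.
have n2 : \forall x' \near x, ball x e x' by exact: nbhsx_ballx.
have n1' : \forall p \near (w, x), ball (alpha w) e (alpha p.1) by exact: cvg_fst n1.
have n2' : \forall p \near (w, x), ball x e p.2 by exact: cvg_snd n2.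
apply: filterS2 n1' n2' => -[w' x'] /=; rewrite !ballEmdist /= => h1 h2.
have t1 := metric_triangle (alpha w') (alpha w) x'.
have t2 := metric_triangle (alpha w) x x'.
move: t1; rewrite [mdist _ (alpha w)]metric_sym => t1.
have : e + e = eps - mdist (alpha w) x by rewrite /e -splitr.
lra.
Qed.

Theorem theorem30 (R : realType) (d m : nat)
  (M : metricType R) (A : smooth_atlas (R := R) M d)
  (M_connected : connected [set: M]) (M_second_countable : @second_countable M)
  (Omega : metricType R) (Omega_compact : compact [set: Omega])
  (sigma : R -> Omega -> Omega)
  (sigma_flow : continuous_flow sigma) (sigma_minimal : minimal_flow sigma)
  (f : 'I_m.+1 -> Omega * M -> tangent_bundle A)
  (f_continuous : forall i, continuous (f i))
  (f_C1 : forall i w, C1_vector_field (fun x => f i (w, x)))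
  (U : set 'rV[R]_m)
  (U_compact : compact U) (U_convex : convex_set U) (U0 : U 0)
  (J : Omega -> M -> (R -> 'rV[R]_m) -> set R)
  (phi : R -> Omega -> M -> (R -> 'rV[R]_m) -> M)
  (phi_solution : solution_map sigma f U J phi)
  (alpha : Omega -> M) (alpha_continuous : continuous alpha)
  (alpha_equilibrium : equilibrium sigma J phi alpha)
  (eps T : R) (eps_gt0 : 0 < eps) (T_gt0 : 0 < T)
  (reach_ball : forall w,
     ball (alpha (sigma T w)) eps `<=` reach U J phi T w (alpha w))
  (controllable_ball : forall w,
     ball (alpha (sigma (- T) w)) eps
       `<=` controllable sigma U J phi T w (alpha w)) :
  exists D : set (Omega * M),
    [/\ control_set sigma U J phi D,
        (forall w, D (w, alpha w)) &
        (forall w, interior [set x | D (w, x)] (alpha w))].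
Proof.
have f_foot i w x : foot (f i (w, x)) = x by have [] := f_C1 i w.
pose Re := ext_reach sigma U J phi.
have Re_trans w x w' x' p : Re w x (w', x') -> Re w' x' p -> Re w x p.
  exact: (ext_reach_trans f_foot f_continuous sigma_flow U_compact phi_solution).
have c0 : control U (fun=> 0) by exact: control0.
have alpha_Re w t : 0 <= t -> Re w (alpha w) (sigma t w, alpha (sigma t w)).
  by move=> t0; have [Jt ->] := alpha_equilibrium t w; exact: ext_reachI.
have Re_graph w x : ball (alpha w) eps x -> Re w x (sigma T w, alpha (sigma T w)).
  rewrite -{1}(flowNK sigma_flow T w) => /controllable_ball[u [cu]].
  rewrite (flowNK sigma_flow) => JT ->.
  by apply: ext_reachI => //; exact: ltW.
have graph_Re w x : ball (alpha w) eps x ->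
    Re (sigma (- T) w) (alpha (sigma (- T) w)) (w, x).
  rewrite -{1}(flowK sigma_flow T w) => /reach_ball[u [cu JT ->]].
  rewrite -{3}(flowK sigma_flow T w).
  by apply: ext_reachI => //; exact: ltW.
(* if the closure of Re w x meets the graph, then so does Re w x *)
have closure_graph w x w' : closure (Re w x) (w', alpha w') ->
    exists w2, Re w x (w2, alpha w2).
  have near_graph : nbhs (w', alpha w') [set p | ball (alpha p.1) eps p.2].
    by apply: ball_graph_near; [exact: alpha_continuous|exact: ballxx].
  move=> /(_ _ near_graph)[[w2 x2] [R2 /= /Re_graph R3]].
  by exists (sigma T w2); exact: Re_trans R3.
pose X := [set p : Omega * M | forall w, closure (Re w (alpha w)) p].
pose Y := [set p : Omega * M | exists w, Re p.1 p.2 (w, alpha w)].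
have ballX w x : ball (alpha w) eps x -> X (w, x).
  move=> wx w1 N nN.
  have [[N1 N2] /= [nN1 nN2] HN] := filterI nN
    (ball_graph_near (alpha_continuous w) wx).
  (* t >= T leaves time to flow along the graph before the steering of length T *)
  have [t [Tt N1t]] := minimal_recurrence Omega_compact sigma_flow sigma_minimal w1 T nN1.
  have [Nt ballt] := HN (sigma t w1, x) (conj N1t (nbhs_singleton nN2)).
  exists (sigma t w1, x); split=> //; apply: Re_trans (graph_Re _ _ ballt).
  by rewrite -(flowD sigma_flow); apply: alpha_Re; lra.
pose D := X `&` Y.
have ballD w x : ball (alpha w) eps x -> D (w, x).
  by move=> wx; split; [exact: ballX|exists (sigma T w); exact: Re_graph].
have graphD w : D (w, alpha w) by apply: ballD; exact: ballxx.
exists D; split=> //; last first.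
  move=> w; apply/nbhs_ballP; exists eps => //= x; exact: ballD.
split; first split.
- by have [w _] := sigma_minimal.1; exists (w, alpha w).
- move=> w x [Xp [w2 /= [b [u [b0 cu Jb [w2E aE]]]]]].
  (* steer onto the graph at time b, then follow it with the control 0 *)
  have [u' [cu' u'1 u'2]] := phi_cat f_foot f_continuous sigma_flow U_compact
    phi_solution cu c0 b0 Jb.
  exists u' => // t t0; have [tb|bt] := leP t b.
    have [|Jt' Et] := u'1 t; first by rewrite t0 tb.
    have Jt : J w x u t by apply: (J_segment phi_solution cu Jb); rewrite t0.
    split=> //; rewrite /psi Et; split.
      move=> w1; exact: (closure_ext_reach_invariant f_foot f_continuous sigma_flow
        U_compact phi_solution (Xp w1) cu t0 Jt).
    exists w2 => /=; have := @phi_shift_sub _ _ _ _ _ _ _ f _ _ _ f_foot f_continuous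
      sigma_flow U_compact phi_solution w x u t (b - t) cu Jt.
    rewrite subrK => /(_ Jb)[Jbt Ebt].
    exists (b - t), (fun s => u (s + t)); split=> //; first by rewrite subr_ge0.
      exact: control_shift.
    by rewrite /psi Ebt -(flowD sigma_flow) subrK -w2E -aE.
  have [] := alpha_equilibrium (t - b) (sigma b w).
  move: aE; rewrite w2E => ->.
  move=> Jt Et; have [|Jt' Et'] := u'2 (t - b) _ Jt; first by rewrite subr_ge0 ltW.
  rewrite subrK in Jt' Et'; split=> //; rewrite /psi Et' -Et -(flowD sigma_flow) subrK.
  exact: graphD.
- move=> w x [_ [w2 /= R2]] q [Xq _].
  by apply: closure_subset (Xq w2) => p; exact: Re_trans.
move=> D' [_ _ D'2] DD'; apply/seteqP; split=> // -[w x] D'q; split.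
  by move=> w1; exact: (D'2 _ _ (DD' _ (graphD w1))).
by have := D'2 _ _ D'q _ (DD' _ (graphD w)) => /closure_graph.
Qed.
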